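(* For every integer $r\geq 10$, the Vietoris--Rips complex $\mathrm{VR}(\mathbb{Z}^6;r)$ is contractible.
   Context: $\mathbb{Z}^6$ is equipped with the Manhattan metric $d(x,y)=\sum_{i=1}^6 |x_i-y_i|$. For a metric space $X$ and $r\geq 0$, $\mathrm{VR}(X;r)$ is the simplicial complex with vertex set $X$ whose simplices are the finite subsets of $X$ of diameter at most $r$. *)

(* Defs.v *)
From HB Require Import structures.
From mathcomp Require Import all_boot all_order all_algebra finmap.
From mathcomp Require Import all_classical all_reals all_analysis.
From mathcomp Require Import Rstruct Rstruct_topology.
From Stdlib Require Rdefinitions.
Notation R := Rdefinitions.R.

Set Implicit Arguments.
Unset Strict Implicit.
Unset Printing Implicit Defensive.

Import Order.TTheory GRing.Theory Num.Theory.
Local Open Scope classical_set_scope.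
Local Open Scope ring_scope.
Local Open Scope fset_scope.

Definition Z6 := 'rV[int]_6.

Definition manhattan (x y : Z6) : nat := (\sum_(i < 6) absz (x ord0 i - y ord0 i))%N.

Definition VR_simplex (X : choiceType) (d : X -> X -> nat) (r : nat)
  (s : {fset X}) : Prop :=
  forall x y, x \in s -> y \in s -> leq (d x y) r.

(** Geometric realization |K| of an (abstract) simplicial complex K on the
    vertex set X, whose simplices are the finite sets s with K s:
    the functions x : X -> R (barycentric coordinates), nonnegative, supported
    in some simplex of K, with coordinates summing to 1.  It is a subset of the
    product space R^X (topology of pointwise convergence), and carries the
    subspace topology. *)
Definition realization (X : choiceType) (K : {fset X} -> Prop)
  : set {ptws X -> R} :=
  [set x | (forall v, 0 <= x v) /\
           exists s : {fset X}, [/\ K s, (forall v, v \notin s -> x v = 0) &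
                                    \sum_(v <- s) x v = 1]].

Definition contractible (T : topologicalType) (A : set T) : Prop :=
  exists p : T, A p /\
  exists H : R * T -> T,
    [/\ {within (`[0, 1]%classic `*` A), continuous H},
        (forall t x, (`[0, 1]%classic : set R) t -> A x -> A (H (t, x))),
        (forall x, A x -> H (0, x) = x) &
        (forall x, A x -> H (1, x) = p)].

(* Main.v *)
(** Exhaust [Z^6] by boxes, each obtained from the previous one by adding a single face
    [x_i = c].  The simplices of the larger box that meet the new face are removed by elementary
    collapses: such a simplex [t] with [s = t ∩ face] is matched with [t ∪ {z}] or [t \ {z}],
    where [z] depends only on [s], lies in the neighbouring hyperplane, and is at distance at most
    [r] from [s] and from every point of the smaller box that is at distance at most [r] from [s].
    Running the resulting deformation retractions during the intervals [2^-(n+1), 2^-n]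
    contracts the union, and local finiteness makes the contraction continuous.

    Deleting the [i]-th coordinate turns the search for [z] into a question about a finite set [S]
    of diameter at most [r] in [Z^5]: find [z] in its box hull with [|y - z| < r] for all [y] in [S],
    and [|w - z| <= rho + 1] whenever [S] lies in the ball of radius [rho] around [w].  Points [v]
    of [S] are treated one at a time.  If the current [z] is too far from [v], it is replaced by a
    point [s] between [v] and [z] such that [|w - s| <= max(|w - v|, |w - z|)] for all [w] (if
    [|v - z|] is odd) or [|w - s| <= max(|w - v| + 1, |w - z|)] (if it is even, after adding
    a sixth coordinate that restores oddness); a parity argument gives the strict inequalities.
    Such an inequality for all [w] amounts to finitely many linear conditions on [m = z - v].
    Apart from five sporadic [m] with a choice of their own, one of four fixed choices of [s - v],
    up to [s |-> m - s], works, except for ten exceptional [m]; for these, points of [S] that rule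
    out each of several candidates would be at distance more than [r] from one another. *)

Require Import Defs.
From Stdlib Require Import ZArith Lia Classical.

(** * Convexity of the taxicab norm, up to parity *)

Section Integers.
Local Open Scope Z_scope.

(* The possible values of [a = |y| - |y - s|] and [e = |y| - |y - m|], where [t] is [y] clamped to
   [[0, s]]. *)
Definition gains (s m a e : Z) :=
  exists t, 0 <= t <= s /\ a = 2 * t - s /\ (t = s -> e <= m) /\ (t < s -> e = 2 * t - m).

Lemma gainsP (y s m : Z) : 0 <= s <= m ->
  gains s m (Z.abs y - Z.abs (y - s)) (Z.abs y - Z.abs (y - m)).
Proof. exists (Z.max 0 (Z.min y s)); lia. Qed.

Definition dist6 (a1 a2 a3 a4 a5 a6 b1 b2 b3 b4 b5 b6 : Z) :=
  Z.abs (a1 - b1) + Z.abs (a2 - b2) + Z.abs (a3 - b3) +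
  Z.abs (a4 - b4) + Z.abs (a5 - b5) + Z.abs (a6 - b6).

Definition norm6 (a1 a2 a3 a4 a5 a6 : Z) :=
  Z.abs a1 + Z.abs a2 + Z.abs a3 + Z.abs a4 + Z.abs a5 + Z.abs a6.

Definition hull6 (m1 m2 m3 m4 m5 m6 s1 s2 s3 s4 s5 s6 : Z) := forall y1 y2 y3 y4 y5 y6,
  dist6 y1 y2 y3 y4 y5 y6 s1 s2 s3 s4 s5 s6 <=
  Z.max (norm6 y1 y2 y3 y4 y5 y6) (dist6 y1 y2 y3 y4 y5 y6 m1 m2 m3 m4 m5 m6).

(** The two alternatives say that [s] is no farther from [y] than 0, respectively than [m]. Both
    depend only on the coordinatewise gains. *)
Lemma hull6_gains m1 m2 m3 m4 m5 m6 s1 s2 s3 s4 s5 s6 :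
  0 <= s1 <= m1 -> 0 <= s2 <= m2 -> 0 <= s3 <= m3 ->
  0 <= s4 <= m4 -> 0 <= s5 <= m5 -> 0 <= s6 <= m6 ->
  (forall a1 a2 a3 a4 a5 a6 e1 e2 e3 e4 e5 e6,
    gains s1 m1 a1 e1 -> gains s2 m2 a2 e2 -> gains s3 m3 a3 e3 ->
    gains s4 m4 a4 e4 -> gains s5 m5 a5 e5 -> gains s6 m6 a6 e6 ->
    0 <= a1 + a2 + a3 + a4 + a5 + a6 \/
    e1 + e2 + e3 + e4 + e5 + e6 <= a1 + a2 + a3 + a4 + a5 + a6) ->
  hull6 m1 m2 m3 m4 m5 m6 s1 s2 s3 s4 s5 s6.
Proof.
intros h1 h2 h3 h4 h5 h6 H y1 y2 y3 y4 y5 y6.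
specialize (H _ _ _ _ _ _ _ _ _ _ _ _
  (gainsP y1 _ _ h1) (gainsP y2 _ _ h2) (gainsP y3 _ _ h3)
  (gainsP y4 _ _ h4) (gainsP y5 _ _ h5) (gainsP y6 _ _ h6)).
unfold dist6, norm6 in *. revert H.
generalize (Z.abs y1) (Z.abs y2) (Z.abs y3) (Z.abs y4) (Z.abs y5) (Z.abs y6).
generalize (Z.abs (y1 - s1)) (Z.abs (y2 - s2)) (Z.abs (y3 - s3))
  (Z.abs (y4 - s4)) (Z.abs (y5 - s5)) (Z.abs (y6 - s6)).
generalize (Z.abs (y1 - m1)) (Z.abs (y2 - m2)) (Z.abs (y3 - m3))
  (Z.abs (y4 - m4)) (Z.abs (y5 - m5)) (Z.abs (y6 - m6)).
clear; lia.
Qed.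

Ltac gains_tac :=
  apply hull6_gains; try lia;
  intros ? ? ? ? ? ? ? ? ? ? ? ? (t1 & ?) (t2 & ?) (t3 & ?) (t4 & ?) (t5 & ?) (t6 & ?); lia.

(** Here [a1] and [a2] are 1 or -1 and the other gains vanish, so a negative total forces both to be
    -1. Then [e1 = -m1] and [e2 = -m2], while the other [e] are at most [m3], ..., [m6]. The next
    three lemmas rest on the same case distinction. *)
Lemma hull6_110000 m1 m2 m3 m4 m5 m6 : 1 <= m2 <= m1 -> 0 <= m3 -> 0 <= m4 -> 0 <= m5 -> 0 <= m6 ->
  m3 + m4 + m5 + m6 + 2 <= m1 + m2 -> hull6 m1 m2 m3 m4 m5 m6 1 1 0 0 0 0.
Proof. intros. gains_tac. Qed.

Lemma hull6_111100 m1 m2 m3 m4 m5 m6 : 1 <= m4 -> m4 <= m3 -> m3 <= m2 -> m2 <= m1 ->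
  0 <= m5 -> 0 <= m6 ->
  m1 + m5 + m6 + 2 <= m2 + m3 + m4 -> hull6 m1 m2 m3 m4 m5 m6 1 1 1 1 0 0.
Proof. intros. gains_tac. Qed.
Lemma hull6_100000 m1 m2 m3 m4 m5 m6 : 0 <= m5 -> m5 <= m4 -> m4 <= m3 -> m3 <= m2 -> m2 <= m1 ->
  0 <= m6 ->
  m2 + m3 + m4 + m5 + m6 + 1 <= m1 -> hull6 m1 m2 m3 m4 m5 m6 1 0 0 0 0 0.
Proof. intros. gains_tac. Qed.
Lemma hull6_211110 m1 m2 m3 m4 m5 m6 : 1 <= m5 -> m5 <= m4 -> m4 <= m3 -> m3 <= m2 -> m2 <= m1 ->
  0 <= m6 -> 2 <= m1 ->
  m1 + m6 + 2 <= m2 + m3 + m4 + m5 ->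
  4 + m2 + m6 <= m1 + m3 + m4 + m5 ->
  2 + m2 + m3 + m6 <= m1 + m4 + m5 ->
  6 + m6 <= m1 + m2 + m3 + m4 + m5 ->
  hull6 m1 m2 m3 m4 m5 m6 2 1 1 1 1 0.
Proof. intros. gains_tac. Qed.

Definition is5 (m1 m2 m3 m4 m5 a1 a2 a3 a4 a5 : Z) :=
  m1 = a1 /\ m2 = a2 /\ m3 = a3 /\ m4 = a4 /\ m5 = a5.

(** Each negated hypothesis is the region of one of the four general choices; outside them only a
    bounded set of vectors is left. The inequality [6 + m6 <= m1 + m2 + m3 + m4 + m5] of
    [hull6_211110] follows from the total being at least 11. *)
Lemma residual m1 m2 m3 m4 m5 m6 : 0 <= m5 -> m5 <= m4 -> m4 <= m3 -> m3 <= m2 -> m2 <= m1 ->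
  0 <= m6 <= 1 -> 11 <= m1 + m2 + m3 + m4 + m5 + m6 -> (m1 + m2 + m3 + m4 + m5 + m6) mod 2 = 1 ->
  ~ (1 <= m2 /\ m3 + m4 + m5 + m6 + 2 <= m1 + m2) ->
  ~ (1 <= m4 /\ m1 + m5 + m6 + 2 <= m2 + m3 + m4) ->
  ~ (m2 + m3 + m4 + m5 + m6 + 1 <= m1) ->
  ~ (1 <= m5 /\ 2 <= m1 /\ m1 + m6 + 2 <= m2 + m3 + m4 + m5 /\
     4 + m2 + m6 <= m1 + m3 + m4 + m5 /\ 2 + m2 + m3 + m6 <= m1 + m4 + m5) ->
  m6 = 1 /\ m1 <= 6 /\ m5 <= 2 /\ m4 <= 3 /\ m3 <= 4 /\ m2 <= 4.
Proof. intros. lia. Qed.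

(* The two lists come from enumerating the vectors bounded by [residual]; in the sporadic cases a
   point [s] exists, but not among the four general choices. *)
Definition exceptional (m1 m2 m3 m4 m5 : Z) :=
  is5 m1 m2 m3 m4 m5 4 2 2 1 1 \/ is5 m1 m2 m3 m4 m5 3 3 2 1 1 \/
  is5 m1 m2 m3 m4 m5 3 2 2 2 1 \/ is5 m1 m2 m3 m4 m5 5 2 2 2 1 \/
  is5 m1 m2 m3 m4 m5 4 3 3 1 1 \/ is5 m1 m2 m3 m4 m5 4 3 2 2 1 \/
  is5 m1 m2 m3 m4 m5 3 3 2 2 2 \/ is5 m1 m2 m3 m4 m5 5 3 3 2 1 \/
  is5 m1 m2 m3 m4 m5 4 3 3 2 2 \/ is5 m1 m2 m3 m4 m5 5 4 3 2 2.

Definition sporadic (m1 m2 m3 m4 m5 : Z) :=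
  is5 m1 m2 m3 m4 m5 4 2 2 2 0 \/ is5 m1 m2 m3 m4 m5 2 2 2 2 2 \/
  is5 m1 m2 m3 m4 m5 6 2 2 2 2 \/ is5 m1 m2 m3 m4 m5 4 4 2 2 2 \/
  is5 m1 m2 m3 m4 m5 6 4 4 2 2.

Ltac range v lo hi :=
  let rec go l := tryif (let x := eval compute in (hi <? l) in constr_eq x true) then exfalso; lia
    else (destruct (Z.eq_dec v l) as [->|?]; [try (exfalso; lia) |
      let l' := eval compute in (l + 1) in go l']) in go lo.

Lemma residual_list m1 m2 m3 m4 m5 m6 : 0 <= m5 -> m5 <= m4 -> m4 <= m3 -> m3 <= m2 -> m2 <= m1 ->
  0 <= m6 <= 1 -> 11 <= m1 + m2 + m3 + m4 + m5 + m6 -> (m1 + m2 + m3 + m4 + m5 + m6) mod 2 = 1 ->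
  ~ (1 <= m2 /\ m3 + m4 + m5 + m6 + 2 <= m1 + m2) ->
  ~ (1 <= m4 /\ m1 + m5 + m6 + 2 <= m2 + m3 + m4) ->
  ~ (m2 + m3 + m4 + m5 + m6 + 1 <= m1) ->
  ~ (1 <= m5 /\ 2 <= m1 /\ m1 + m6 + 2 <= m2 + m3 + m4 + m5 /\
     4 + m2 + m6 <= m1 + m3 + m4 + m5 /\ 2 + m2 + m3 + m6 <= m1 + m4 + m5) ->
  m6 = 1 /\ (exceptional m1 m2 m3 m4 m5 \/ sporadic m1 m2 m3 m4 m5).
Proof.
intros h5 h4 h3 h2 h1 h6 hs hp na nb nc nd.
assert (m6 = 1 /\ m1 <= 6 /\ m5 <= 2 /\ m4 <= 3 /\ m3 <= 4 /\ m2 <= 4) as (e6 & b1 & b5 & b4 & b3 & b2)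
  by (now apply (residual m1 m2 m3 m4 m5 m6)).
split; [exact e6|]; subst m6.
unfold exceptional, sporadic, is5.
range m5 0 2; range m4 0 3; range m3 0 4; range m2 0 4; range m1 2 6; tauto.
Qed.

Lemma hull6_exists m1 m2 m3 m4 m5 m6 : 0 <= m5 -> m5 <= m4 -> m4 <= m3 -> m3 <= m2 -> m2 <= m1 ->
  0 <= m6 <= 1 -> 11 <= m1 + m2 + m3 + m4 + m5 + m6 -> (m1 + m2 + m3 + m4 + m5 + m6) mod 2 = 1 ->
  (exists s1 s2 s3 s4 s5 s6,
    (0 <= s1 <= m1 /\ 0 <= s2 <= m2 /\ 0 <= s3 <= m3 /\
     0 <= s4 <= m4 /\ 0 <= s5 <= m5 /\ 0 <= s6 <= m6) /\
    0 < s1 + s2 + s3 + s4 + s5 + s6 < m1 + m2 + m3 + m4 + m5 + m6 /\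
    hull6 m1 m2 m3 m4 m5 m6 s1 s2 s3 s4 s5 s6) \/
  (m6 = 1 /\ exceptional m1 m2 m3 m4 m5).
Proof.
intros h5 h4 h3 h2 h1 h6 hs hp.
destruct (Z_lt_dec m2 1); [left; exists 1,0,0,0,0,0; repeat split; try lia; apply hull6_100000; lia|].
destruct (Z_le_dec (m3 + m4 + m5 + m6 + 2) (m1 + m2)).
  left; exists 1,1,0,0,0,0; repeat split; try lia; apply hull6_110000; lia.
destruct (Z_le_dec 1 m4) as [c1|c1]; destruct (Z_le_dec (m1 + m5 + m6 + 2) (m2 + m3 + m4)) as [c2|c2];
 try (left; exists 1,1,1,1,0,0; repeat split; try lia; apply hull6_111100; lia).
all: destruct (Z_le_dec (m2 + m3 + m4 + m5 + m6 + 1) m1) as [c3|c3];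
 [left; exists 1,0,0,0,0,0; repeat split; try lia; apply hull6_100000; lia|].
all: assert (D : (1 <= m5 /\ 2 <= m1 /\ m1 + m6 + 2 <= m2 + m3 + m4 + m5 /\
     4 + m2 + m6 <= m1 + m3 + m4 + m5 /\ 2 + m2 + m3 + m6 <= m1 + m4 + m5) \/
   ~ (1 <= m5 /\ 2 <= m1 /\ m1 + m6 + 2 <= m2 + m3 + m4 + m5 /\
     4 + m2 + m6 <= m1 + m3 + m4 + m5 /\ 2 + m2 + m3 + m6 <= m1 + m4 + m5)) by lia;
 destruct D as [D|D]; [left; exists 2,1,1,1,1,0; repeat split; try lia; apply hull6_211110; lia|].
all: destruct (residual_list m1 m2 m3 m4 m5 m6) as [e [E|S]]; try lia; auto.
(* All coordinates of a sporadic vector are even, and [s] is half of it, with sixth coordinate 0. *)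
all: left; unfold sporadic, is5 in S;
 destruct S as [(->&->&->&->&->)|[(->&->&->&->&->)|[(->&->&->&->&->)|[(->&->&->&->&->)|(->&->&->&->&->)]]]];
 subst m6;
 [exists 2,1,1,1,0,0|exists 1,1,1,1,1,0|exists 3,1,1,1,1,0|exists 2,2,1,1,1,0|exists 3,2,2,1,1,0];
 (split; [lia|split; [lia|gains_tac]]).
Qed.

(** The reflection [y |-> m - y] exchanges 0 with [m] and [s] with [m - s]. *)
Lemma hull6_compl m1 m2 m3 m4 m5 m6 s1 s2 s3 s4 s5 s6 :
  hull6 m1 m2 m3 m4 m5 m6 s1 s2 s3 s4 s5 s6 ->
  hull6 m1 m2 m3 m4 m5 m6 (m1 - s1) (m2 - s2) (m3 - s3) (m4 - s4) (m5 - s5) (m6 - s6).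
Proof.
intros H y1 y2 y3 y4 y5 y6.
assert (E : forall m s y, Z.abs (y - (m - s)) = Z.abs (m - y - s)) by lia.
assert (F : forall m y, Z.abs (y - m) = Z.abs (m - y)) by lia.
assert (G : forall m y, Z.abs y = Z.abs (m - y - m)) by lia.
specialize (H (m1 - y1) (m2 - y2) (m3 - y3) (m4 - y4) (m5 - y5) (m6 - y6)).
rewrite Z.max_comm; unfold dist6, norm6 in *; rewrite !E, !(F _ y1), !(F _ y2), !(F _ y3).
rewrite !(F _ y4), !(F _ y5), !(F _ y6), (G m1 y1), (G m2 y2), (G m3 y3), (G m4 y4), (G m5 y5).
now rewrite (G m6 y6).
Qed.

(** As [m] has odd total, exactly one of [s] and [m - s] has odd total; the two strict bounds in
    [hull6_exists] make either choice shorter than [m]. *)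
Lemma hull6_odd m1 m2 m3 m4 m5 m6 : 0 <= m5 -> m5 <= m4 -> m4 <= m3 -> m3 <= m2 -> m2 <= m1 ->
  0 <= m6 <= 1 -> 11 <= m1 + m2 + m3 + m4 + m5 + m6 -> (m1 + m2 + m3 + m4 + m5 + m6) mod 2 = 1 ->
  (exists s1 s2 s3 s4 s5 s6,
    (0 <= s1 <= m1 /\ 0 <= s2 <= m2 /\ 0 <= s3 <= m3 /\
     0 <= s4 <= m4 /\ 0 <= s5 <= m5 /\ 0 <= s6 <= m6) /\
    s1 + s2 + s3 + s4 + s5 + s6 < m1 + m2 + m3 + m4 + m5 + m6 /\
    (s1 + s2 + s3 + s4 + s5 + s6) mod 2 = 1 /\
    hull6 m1 m2 m3 m4 m5 m6 s1 s2 s3 s4 s5 s6) \/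
  (m6 = 1 /\ exceptional m1 m2 m3 m4 m5).
Proof.
intros h5 h4 h3 h2 h1 h6 hs hp.
destruct (hull6_exists m1 m2 m3 m4 m5 m6) as [(s1 & s2 & s3 & s4 & s5 & s6 & hb & hl & hh)|E]; auto; left.
destruct (Z.eq_dec ((s1 + s2 + s3 + s4 + s5 + s6) mod 2) 1).
  exists s1, s2, s3, s4, s5, s6; repeat split; auto; lia.
exists (m1 - s1), (m2 - s2), (m3 - s3), (m4 - s4), (m5 - s5), (m6 - s6).
split; [lia|split; [lia|split; [|now apply hull6_compl]]].
replace (m1 - s1 + (m2 - s2) + (m3 - s3) + (m4 - s4) + (m5 - s5) + (m6 - s6))
  with ((m1 + m2 + m3 + m4 + m5 + m6) - (s1 + s2 + s3 + s4 + s5 + s6)) by ring.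
revert hp n; generalize (m1 + m2 + m3 + m4 + m5 + m6) (s1 + s2 + s3 + s4 + s5 + s6); clear.
intros a b ha hb; Z.to_euclidean_division_equations; lia.
Qed.

(** * Blocking points for the exceptional vectors *)

Definition dist5 (a1 a2 a3 a4 a5 b1 b2 b3 b4 b5 : Z) :=
  Z.abs (a1 - b1) + Z.abs (a2 - b2) + Z.abs (a3 - b3) +
  Z.abs (a4 - b4) + Z.abs (a5 - b5).

Definition norm5 (a1 a2 a3 a4 a5 : Z) :=
  Z.abs a1 + Z.abs a2 + Z.abs a3 + Z.abs a4 + Z.abs a5.

(* [c] is [y] clamped to [[0, m]] and [n = |y|] *)
Definition regime (m y c n : Z) :=
  if c =? 0 then y <= 0 /\ n = - y else
  if c =? m then m <= y /\ n = y else y = c /\ n = c.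

Lemma regimeP m y : 0 < m -> regime m y (Z.max 0 (Z.min y m)) (Z.abs y).
Proof.
intros m0; unfold regime.
destruct (Z.eqb_spec (Z.max 0 (Z.min y m)) 0); [lia|].
destruct (Z.eqb_spec (Z.max 0 (Z.min y m)) m); lia.
Qed.

(** With the point being treated at 0 and the current center at [m], such a [y] prevents [s] from
    being the next center. *)
Definition blocks r m1 m2 m3 m4 m5 s1 s2 s3 s4 s5 y1 y2 y3 y4 y5 :=
  norm5 y1 y2 y3 y4 y5 <= r /\
  dist5 y1 y2 y3 y4 y5 m1 m2 m3 m4 m5 <= r - 1 /\
  r <= dist5 y1 y2 y3 y4 y5 s1 s2 s3 s4 s5.

Lemma abs_sub_clamp m s y : 0 <= s <= m ->
  Z.abs (y - s) = Z.abs y + s - 2 * Z.min (Z.max 0 (Z.min y m)) s.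
Proof. lia. Qed.

(** Where the clamped coordinates are constant, the distances from [y] to 0, [s] and [m] are affine
    in [y], so a blocking point falls into one of finitely many linear cases. *)
Lemma blocks_regimes r m1 m2 m3 m4 m5 s1 s2 s3 s4 s5 y1 y2 y3 y4 y5 :
  0 < m1 -> 0 < m2 -> 0 < m3 -> 0 < m4 -> 0 < m5 ->
  0 <= s1 <= m1 -> 0 <= s2 <= m2 -> 0 <= s3 <= m3 -> 0 <= s4 <= m4 -> 0 <= s5 <= m5 ->
  blocks r m1 m2 m3 m4 m5 s1 s2 s3 s4 s5 y1 y2 y3 y4 y5 ->
  exists c1 c2 c3 c4 c5 n1 n2 n3 n4 n5,
  (regime m1 y1 c1 n1 /\ regime m2 y2 c2 n2 /\ regime m3 y3 c3 n3 /\
   regime m4 y4 c4 n4 /\ regime m5 y5 c5 n5) /\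
  (0 <= c1 <= m1 /\ 0 <= c2 <= m2 /\ 0 <= c3 <= m3 /\ 0 <= c4 <= m4 /\ 0 <= c5 <= m5) /\
  n1 + n2 + n3 + n4 + n5 <= r /\
  2 * (Z.min c1 s1 + Z.min c2 s2 + Z.min c3 s3 + Z.min c4 s4 + Z.min c5 s5)
    - (s1 + s2 + s3 + s4 + s5) <= n1 + n2 + n3 + n4 + n5 - r /\
  1 + (n1 + n2 + n3 + n4 + n5) - r <= 2 * (c1 + c2 + c3 + c4 + c5) - (m1 + m2 + m3 + m4 + m5).
Proof.
intros p1 p2 p3 p4 p5 h1 h2 h3 h4 h5; unfold blocks, norm5, dist5; intros (hn & hm & hs).
rewrite (abs_sub_clamp m1 s1), (abs_sub_clamp m2 s2), (abs_sub_clamp m3 s3),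
  (abs_sub_clamp m4 s4), (abs_sub_clamp m5 s5) in hs by assumption.
assert (E : forall m, 0 < m -> 0 <= m <= m) by (clear; lia).
rewrite (abs_sub_clamp m1 m1), (abs_sub_clamp m2 m2), (abs_sub_clamp m3 m3),
  (abs_sub_clamp m4 m4), (abs_sub_clamp m5 m5) in hm by auto.
do 5 eexists; do 5 eexists; split; [repeat split; apply regimeP; assumption|].
split; [revert p1 p2 p3 p4 p5; clear; lia|].
assert (M : forall y m, Z.min (Z.max 0 (Z.min y m)) m <= (Z.max 0 (Z.min y m))) by (clear; lia).
pose proof (M y1 m1). pose proof (M y2 m2). pose proof (M y3 m3). pose proof (M y4 m4). pose proof (M y5 m5).
revert hs hm hn H H0 H1 H2 H3; clear.
generalize (Z.abs y1) (Z.abs y2) (Z.abs y3) (Z.abs y4) (Z.abs y5).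
generalize (Z.max 0 (Z.min y1 m1)) (Z.max 0 (Z.min y2 m2)) (Z.max 0 (Z.min y3 m3))
 (Z.max 0 (Z.min y4 m4)) (Z.max 0 (Z.min y5 m5)).
intros z z0 z1 z2 z3.
generalize (Z.min z m1) (Z.min z0 m2) (Z.min z1 m3) (Z.min z2 m4) (Z.min z3 m5).
generalize (Z.min z s1) (Z.min z0 s2) (Z.min z1 s3) (Z.min z2 s4) (Z.min z3 s5).
lia.
Qed.

(** The auxiliary bounds keep the clash of two blocking points linear, without splitting on the
    signs of absolute values. *)
Lemma dist5_ge u1 u2 u3 u4 u5 v1 v2 v3 v4 v5 r : dist5 u1 u2 u3 u4 u5 v1 v2 v3 v4 v5 <= r ->
 exists d1 d2 d3 d4 d5, (u1 - v1 <= d1 /\ v1 - u1 <= d1) /\ (u2 - v2 <= d2 /\ v2 - u2 <= d2) /\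
  (u3 - v3 <= d3 /\ v3 - u3 <= d3) /\ (u4 - v4 <= d4 /\ v4 - u4 <= d4) /\ (u5 - v5 <= d5 /\ v5 - u5 <= d5)
  /\ d1 + d2 + d3 + d4 + d5 <= r.
Proof. unfold dist5; intros; do 5 eexists; repeat (split; [split|]); cycle -1; [eassumption|..]; lia. Qed.

Ltac locate H :=
  let c1 := fresh "c" in let c2 := fresh "c" in let c3 := fresh "c" in
  let c4 := fresh "c" in let c5 := fresh "c" in
  let r1 := fresh "r" in let r2 := fresh "r" in let r3 := fresh "r" in
  let r4 := fresh "r" in let r5 := fresh "r" in
  let cl := fresh "cl" in let kn := fresh "kn" in let ka := fresh "ka" in let ke := fresh "ke" in
  apply blocks_regimes in H; [|lia..];
  destruct H as (c1 & c2 & c3 & c4 & c5 & ? & ? & ? & ? & ? & (r1 & r2 & r3 & r4 & r5) & cl & kn & ka & ke);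
  match type of cl with
   (_ <= _ <= ?m1) /\ (_ <= _ <= ?m2) /\ (_ <= _ <= ?m3) /\ (_ <= _ <= ?m4) /\ (_ <= _ <= ?m5) =>
   range c1 0 m1; range c2 0 m2; range c3 0 m3; range c4 0 m4; range c5 0 m5
  end;
  repeat match goal with N : ?a <> ?b |- _ => clear N end; cbn in r1, r2, r3, r4, r5, ka, ke; clear cl.

(** This is the inequality [hull6] with [m6 = s6 = 1], at points with [y6 = 1]. *)
Definition hull1 m1 m2 m3 m4 m5 s1 s2 s3 s4 s5 := forall y1 y2 y3 y4 y5,
  dist5 y1 y2 y3 y4 y5 s1 s2 s3 s4 s5 <=
  Z.max (norm5 y1 y2 y3 y4 y5 + 1) (dist5 y1 y2 y3 y4 y5 m1 m2 m3 m4 m5).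

Lemma hull1_gains m1 m2 m3 m4 m5 s1 s2 s3 s4 s5 :
  0 <= s1 <= m1 -> 0 <= s2 <= m2 -> 0 <= s3 <= m3 -> 0 <= s4 <= m4 -> 0 <= s5 <= m5 ->
  (forall a1 a2 a3 a4 a5 e1 e2 e3 e4 e5,
    gains s1 m1 a1 e1 -> gains s2 m2 a2 e2 -> gains s3 m3 a3 e3 ->
    gains s4 m4 a4 e4 -> gains s5 m5 a5 e5 ->
    -1 <= a1 + a2 + a3 + a4 + a5 \/
    e1 + e2 + e3 + e4 + e5 <= a1 + a2 + a3 + a4 + a5) ->
  hull1 m1 m2 m3 m4 m5 s1 s2 s3 s4 s5.
Proof.
intros h1 h2 h3 h4 h5 H y1 y2 y3 y4 y5.
specialize (H _ _ _ _ _ _ _ _ _ _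
  (gainsP y1 _ _ h1) (gainsP y2 _ _ h2) (gainsP y3 _ _ h3)
  (gainsP y4 _ _ h4) (gainsP y5 _ _ h5)).
unfold dist5, norm5 in *. revert H.
generalize (Z.abs y1) (Z.abs y2) (Z.abs y3) (Z.abs y4) (Z.abs y5).
generalize (Z.abs (y1 - s1)) (Z.abs (y2 - s2)) (Z.abs (y3 - s3))
  (Z.abs (y4 - s4)) (Z.abs (y5 - s5)).
generalize (Z.abs (y1 - m1)) (Z.abs (y2 - m2)) (Z.abs (y3 - m3))
  (Z.abs (y4 - m4)) (Z.abs (y5 - m5)).
clear; lia.
Qed.

Definition points := Z -> Z -> Z -> Z -> Z -> Prop.

Definition clique r (Y : points) :=
  forall y1 y2 y3 y4 y5 z1 z2 z3 z4 z5, Y y1 y2 y3 y4 y5 -> Y z1 z2 z3 z4 z5 ->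
  dist5 y1 y2 y3 y4 y5 z1 z2 z3 z4 z5 <= r.

Definition solution r m1 m2 m3 m4 m5 (Y : points) s1 s2 s3 s4 s5 :=
  (0 <= s1 <= m1 /\ 0 <= s2 <= m2 /\ 0 <= s3 <= m3 /\ 0 <= s4 <= m4 /\ 0 <= s5 <= m5) /\
  s1 + s2 + s3 + s4 + s5 <= r - 1 /\ hull1 m1 m2 m3 m4 m5 s1 s2 s3 s4 s5 /\
  (forall y1 y2 y3 y4 y5, Y y1 y2 y3 y4 y5 ->
     dist5 y1 y2 y3 y4 y5 s1 s2 s3 s4 s5 <= r - 1).

Lemma solution_or_blocker r m1 m2 m3 m4 m5 (Y : points) s1 s2 s3 s4 s5 :
  (forall y1 y2 y3 y4 y5, Y y1 y2 y3 y4 y5 -> norm5 y1 y2 y3 y4 y5 <= r /\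
     dist5 y1 y2 y3 y4 y5 m1 m2 m3 m4 m5 <= r - 1) ->
  (0 <= s1 <= m1 /\ 0 <= s2 <= m2 /\ 0 <= s3 <= m3 /\ 0 <= s4 <= m4 /\ 0 <= s5 <= m5) ->
  s1 + s2 + s3 + s4 + s5 <= r - 1 -> hull1 m1 m2 m3 m4 m5 s1 s2 s3 s4 s5 ->
  solution r m1 m2 m3 m4 m5 Y s1 s2 s3 s4 s5 \/
  exists y1 y2 y3 y4 y5, Y y1 y2 y3 y4 y5 /\ blocks r m1 m2 m3 m4 m5 s1 s2 s3 s4 s5 y1 y2 y3 y4 y5.
Proof.
intros hY hs hr hh.
destruct (classic (exists y1 y2 y3 y4 y5, Y y1 y2 y3 y4 y5 /\
  blocks r m1 m2 m3 m4 m5 s1 s2 s3 s4 s5 y1 y2 y3 y4 y5)) as [K|K]; [now right|left].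
split; [exact hs|split; [exact hr|split; [exact hh|]]].
intros y1 y2 y3 y4 y5 y; apply Z.nlt_ge; intros lt; apply K.
exists y1, y2, y3, y4, y5; split; [exact y|].
destruct (hY _ _ _ _ _ y); repeat split; auto.
revert lt; clear; generalize (dist5 y1 y2 y3 y4 y5 s1 s2 s3 s4 s5); lia.
Qed.

Ltac pair C := apply dist5_ge in C; destruct C as (? & ? & ? & ? & ? & C).
Ltac clash hC y y' :=
  let C := fresh in pose proof (hC _ _ _ _ _ _ _ _ _ _ y y') as C; pair C; try (exfalso; lia).
Ltac attempt hY a1 a2 a3 a4 a5 y k :=
  match type of hY with
  | forall y1 y2 y3 y4 y5, ?Y y1 y2 y3 y4 y5 -> norm5 y1 y2 y3 y4 y5 <= ?r /\
     dist5 y1 y2 y3 y4 y5 ?m1 ?m2 ?m3 ?m4 ?m5 <= _ =>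
    destruct (solution_or_blocker r m1 m2 m3 m4 m5 Y a1 a2 a3 a4 a5 hY) as [?|(? & ? & ? & ? & ? & y & k)];
     [lia|lia|apply hull1_gains; try lia;
       intros ? ? ? ? ? ? ? ? ? ? (? & ?) (? & ?) (? & ?) (? & ?) (? & ?); lia
     |exists a1, a2, a3, a4, a5; assumption|]
  end.

(** Several candidates satisfying [hull1] are tried. If none is a solution, each has a blocking
    point in [Y]; whatever regions these points lie in, two of them are more than [r] apart, against
    [clique]. *)
Lemma exceptional_solution r m1 m2 m3 m4 m5 (Y : points) :
  exceptional m1 m2 m3 m4 m5 -> r = m1 + m2 + m3 + m4 + m5 ->
  (forall y1 y2 y3 y4 y5, Y y1 y2 y3 y4 y5 -> norm5 y1 y2 y3 y4 y5 <= r /\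
     dist5 y1 y2 y3 y4 y5 m1 m2 m3 m4 m5 <= r - 1) ->
  clique r Y -> exists s1 s2 s3 s4 s5, solution r m1 m2 m3 m4 m5 Y s1 s2 s3 s4 s5.
Proof.
unfold exceptional, is5.
intros [(->&->&->&->&->)|[(->&->&->&->&->)|[(->&->&->&->&->)|[(->&->&->&->&->)|
 [(->&->&->&->&->)|[(->&->&->&->&->)|[(->&->&->&->&->)|[(->&->&->&->&->)|
 [(->&->&->&->&->)|(->&->&->&->&->)]]]]]]]]] ->;
 match goal with |- context [clique ?r] => let r' := eval compute in r in change r with r' end;
 intros hY hC.
- attempt hY 3 1 2 1 1 y1 k1. attempt hY 3 2 1 1 1 y2 k2.
  attempt hY 1 0 0 0 0 y3 k3. attempt hY 2 1 1 0 0 y4 k4. clear hY.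
  exfalso; locate k1; locate k2; locate k3;
  clash hC y1 y2;
  clash hC y1 y3;
  clash hC y2 y3;
  locate k4;
  clash hC y1 y4;
  clash hC y2 y4;
  clash hC y3 y4.
- attempt hY 2 2 2 1 1 y1 k1. attempt hY 1 1 1 0 0 y2 k2.
  attempt hY 2 2 1 0 1 y3 k3. attempt hY 0 1 0 0 0 y4 k4. attempt hY 1 0 0 0 0 y5 k5. clear hY.
  exfalso; locate k1; locate k2;
  clash hC y1 y2; locate k3;
  clash hC y1 y3;
  clash hC y2 y3.
  (* Each combination of regions that survives the first three blockers is refuted by its own
     further candidate. *)
  + locate k4;
  clash hC y1 y4;
  clash hC y2 y4;
  clash hC y3 y4.
  + locate k5;
  clash hC y1 y5;
  clash hC y2 y5;
  clash hC y3 y5.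
- attempt hY 2 1 1 1 1 y1 k1. attempt hY 1 1 1 1 0 y2 k2. attempt hY 1 1 1 1 1 y3 k3.
  attempt hY 0 1 0 0 0 y4 k4. attempt hY 0 0 1 0 0 y5 k5. attempt hY 0 0 0 1 0 y6 k6. clear hY.
  exfalso; locate k1; locate k2;
  clash hC y1 y2; locate k3;
  clash hC y1 y3;
  clash hC y2 y3.
  + locate k6;
  clash hC y1 y6;
  clash hC y2 y6;
  clash hC y3 y6.
  + locate k5;
  clash hC y1 y5;
  clash hC y2 y5;
  clash hC y3 y5.
  + locate k4;
  clash hC y1 y4;
  clash hC y2 y4;
  clash hC y3 y4.
- attempt hY 3 1 1 1 1 y1 k1. attempt hY 2 1 1 1 0 y2 k2. clear hY.
  exfalso; locate k1; locate k2; clash hC y1 y2.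
- attempt hY 1 1 1 0 0 y1 k1. attempt hY 3 2 2 1 1 y2 k2. clear hY.
  exfalso; locate k1; locate k2; clash hC y1 y2.
- attempt hY 3 2 1 1 1 y1 k1. attempt hY 2 2 1 1 0 y2 k2. attempt hY 3 2 2 2 1 y3 k3. clear hY.
  exfalso; locate k1; locate k2; clash hC y1 y2; locate k3;
  clash hC y1 y3;
  clash hC y2 y3.
- attempt hY 1 1 1 1 1 y1 k1. attempt hY 2 2 1 1 1 y2 k2. clear hY.
  exfalso; locate k1; locate k2; clash hC y1 y2.
- attempt hY 3 2 2 1 1 y1 k1. attempt hY 2 1 1 1 0 y2 k2. clear hY.
  exfalso; locate k1; locate k2; clash hC y1 y2.
- attempt hY 2 2 2 1 1 y1 k1. attempt hY 3 2 2 1 2 y2 k2. attempt hY 3 2 2 2 1 y3 k3. clear hY.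
  exfalso; locate k1; locate k2; clash hC y1 y2; locate k3;
  clash hC y1 y3;
  clash hC y2 y3.
- attempt hY 3 2 2 1 1 y1 k1. attempt hY 2 2 1 1 1 y2 k2. clear hY.
  exfalso; locate k1; locate k2; clash hC y1 y2.
Qed.

End Integers.

From HB Require Import structures.
From mathcomp Require Import all_boot all_order all_algebra all_fingroup finmap.
From mathcomp Require Import zify ssrZ.

Set Implicit Arguments.
Unset Strict Implicit.
Unset Printing Implicit Defensive.

Import Order.TTheory GRing.Theory Num.Theory.
Local Open Scope ring_scope.

(** * Centers of cliques in five dimensions *)

Definition l1 n (x y : 'rV[int]_n) : nat := (\sum_(i < n) absz (x ord0 i - y ord0 i))%N.

Definition between n (x s y : 'rV[int]_n) :=
  forall i, (x ord0 i <= s ord0 i <= y ord0 i) \/ (y ord0 i <= s ord0 i <= x ord0 i).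

Lemma l1xx n (x : 'rV[int]_n) : l1 x x = 0%N.
Proof. by rewrite /l1 big1 // => i _; rewrite subrr. Qed.

Lemma l1C n (x y : 'rV[int]_n) : l1 x y = l1 y x.
Proof. by apply: eq_bigr => i _; rewrite distnC. Qed.

Lemma odd_l1 n (x y z : 'rV[int]_n) : odd (l1 x z) = odd (l1 x y) (+) odd (l1 y z).
Proof.
rewrite -oddD /l1 -big_split /=.
by elim/big_ind2: _ => // [a b c d|i _]; [rewrite !oddD => -> -> | lia].
Qed.

Lemma sum5 (F : 'I_5 -> nat) : (\sum_i F i = F (@Ordinal 5 0 isT) + F (@Ordinal 5 1 isT) +
  F (@Ordinal 5 2 isT) + F (@Ordinal 5 3 isT) + F (@Ordinal 5 4 isT))%N.
Proof.
rewrite !big_ord_recl big_ord0 addn0 !addnA.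
by congr (_ + _ + _ + _ + _)%N; congr F; apply: val_inj.
Qed.

Lemma sort_abs_diff (x y : 'rV[int]_5) : exists p : 'S_5,
  forall i j : 'I_5, (i <= j)%N ->
  (absz (y ord0 (p j) - x ord0 (p j)) <= absz (y ord0 (p i) - x ord0 (p i)))%N.
Proof.
pose t := [tuple absz (y ord0 i - x ord0 i) | i < 5].
pose s := sort geq t.
have ss : size s == 5 by rewrite size_sort size_tuple.
have /tuple_permP[p sp] : perm_eq (Tuple ss) t by rewrite /= perm_sort.
exists p => i j ij.
have E k : absz (y ord0 (p k) - x ord0 (p k)) = nth 0%N s k.
  have -> : s = [tuple tnth t (p i0) | i0 < 5] by [].
  by rewrite -tnth_nth tnth_mktuple tnth_mktuple.
rewrite !E.
have st : sorted geq s by apply: sort_sorted => a b; rewrite /geq; exact: leq_total.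
apply: (sorted_leq_nth (leT := geq)) => //; rewrite ?inE.
- by move=> a b c; rewrite /geq => h1 h2; exact: leq_trans h2 h1.
- by move=> a; exact: leqnn.
- by rewrite (eqP ss) ltn_ord.
- by rewrite (eqP ss) ltn_ord.
Qed.

Delimit Scope Z_scope with coqZ.

Definition flip (x y : 'rV[int]_5) (i : 'I_5) : int := if y ord0 i < x ord0 i then -1 else 1.

Definition coord (x y : 'rV[int]_5) (p : 'S_5) (k : 'I_5) (w : 'rV[int]_5) : Z :=
  Z_of_int (flip x y (p k) * (w ord0 (p k) - x ord0 (p k))).

Lemma l1_coord x y p u w : Z.of_nat (l1 u w) =
  let c k (h : (k < 5)%N) := coord x y p (Ordinal h) in
  dist5 (c 0%N isT u) (c 1%N isT u) (c 2%N isT u) (c 3%N isT u) (c 4%N isT u)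
        (c 0%N isT w) (c 1%N isT w) (c 2%N isT w) (c 3%N isT w) (c 4%N isT w).
Proof.
rewrite /l1 (reindex_inj (@perm_inj _ p)) sum5 /= /dist5 !Nat2Z.inj_add.
have E k : Z.of_nat (absz (u ord0 (p k) - w ord0 (p k))) =
  Z.abs (coord x y p k u - coord x y p k w).
  by rewrite /coord /flip; case: ifP => _; lia.
by rewrite !E.
Qed.

(** Translating [x] to 0, reflecting axes and sorting them preserves distances and [between]; this
    reduces the steps below to the integer lemmas above. *)
Lemma frame (x y : 'rV[int]_5) :
  exists c1 c2 c3 c4 c5 : 'rV[int]_5 -> Z,
  [/\ c1 x = 0%coqZ /\ c2 x = 0%coqZ /\ c3 x = 0%coqZ /\ c4 x = 0%coqZ /\ c5 x = 0%coqZ,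
   (0 <= c5 y /\ c5 y <= c4 y /\ c4 y <= c3 y /\ c3 y <= c2 y /\ c2 y <= c1 y)%coqZ,
   (forall u w, Z.of_nat (l1 u w) =
      dist5 (c1 u) (c2 u) (c3 u) (c4 u) (c5 u) (c1 w) (c2 w) (c3 w) (c4 w) (c5 w)) &
   (forall s1 s2 s3 s4 s5,
      (0 <= s1 <= c1 y /\ 0 <= s2 <= c2 y /\ 0 <= s3 <= c3 y /\ 0 <= s4 <= c4 y /\
       0 <= s5 <= c5 y)%coqZ ->
      exists2 s, between x s y & c1 s = s1 /\ c2 s = s2 /\ c3 s = s3 /\ c4 s = s4 /\ c5 s = s5)].
Proof.
have [p ps] := sort_abs_diff x y.
pose c k := coord x y p k.
have cy k : c k y = Z.of_nat (absz (y ord0 (p k) - x ord0 (p k))).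
  by rewrite /c /coord /flip; case: ifP; lia.
exists (c (@Ordinal 5 0 isT)), (c (@Ordinal 5 1 isT)), (c (@Ordinal 5 2 isT)),
  (c (@Ordinal 5 3 isT)), (c (@Ordinal 5 4 isT)); split.
- by rewrite /c /coord !subrr !mulr0.
- rewrite !cy; have := ps (@Ordinal 5 0 isT) (@Ordinal 5 1 isT) isT.
  have := ps (@Ordinal 5 1 isT) (@Ordinal 5 2 isT) isT.
  have := ps (@Ordinal 5 2 isT) (@Ordinal 5 3 isT) isT.
  have := ps (@Ordinal 5 3 isT) (@Ordinal 5 4 isT) isT.
  by lia.
- by move=> u w; exact: l1_coord.
move=> s1 s2 s3 s4 s5 [h1 [h2 [h3 [h4 h5]]]].
pose S (k : 'I_5) := nth 0%coqZ [:: s1; s2; s3; s4; s5] k.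
have hS k : (0 <= S k <= c k y)%coqZ.
  case: k => [[|[|[|[|[|?]]]]] kp] //=; rewrite /S /=;
  by rewrite (bool_irrelevance kp isT).
pose s : 'rV[int]_5 := \row_i (x ord0 i + flip x y i * int_of_Z (S ((p^-1)%g i))).
have cs k : c k s = S k.
  rewrite /c /coord mxE permK addrAC subrr add0r.
  by rewrite /flip; case: ifP => _; rewrite ?mulN1r ?opprK ?mul1r int_of_ZK.
exists s; last by rewrite !cs.
move=> i; have := hS ((p^-1)%g i); rewrite cy permKV mxE /flip.
move: (S _) => z; case: ifP => yx hz; [right|left]; lia.
Qed.

Lemma dist5_0r a1 a2 a3 a4 a5 : dist5 a1 a2 a3 a4 a5 0 0 0 0 0 = norm5 a1 a2 a3 a4 a5.
Proof. by rewrite /dist5 /norm5 !Z.sub_0_r. Qed.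

Lemma dist5_0l s1 s2 s3 s4 s5 : (0 <= s1)%coqZ -> (0 <= s2)%coqZ -> (0 <= s3)%coqZ ->
  (0 <= s4)%coqZ -> (0 <= s5)%coqZ ->
  dist5 0 0 0 0 0 s1 s2 s3 s4 s5 = (s1 + s2 + s3 + s4 + s5)%coqZ.
Proof.
by move=> h1 h2 h3 h4 h5; rewrite /dist5 !Z.sub_0_l !Z.abs_opp !Z.abs_eq.
Qed.

Lemma odd_mod2 n : (Z.of_nat n mod 2)%coqZ = (if odd n then 1 else 0)%coqZ.
Proof.
rewrite -{1}(odd_double_half n); move: (n./2) => k.
have -> : Z.of_nat (odd n + k.*2) = ((if odd n then 1 else 0) + Z.of_nat k * 2)%coqZ.
  by case: (odd n); lia.
by rewrite Z_mod_plus_full; case: (odd n).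
Qed.

(** This is [hull6_odd] with [m6 = 0], which excludes the exceptional case. *)
Lemma odd_step (x y : 'rV[int]_5) : odd (l1 x y) -> (11 <= l1 x y)%N ->
  exists s, [/\ between x s y, odd (l1 x s), (l1 x s < l1 x y)%N &
    forall w, (l1 w s <= maxn (l1 w x) (l1 w y))%N].
Proof.
move=> oxy gxy; have [c1 [c2 [c3 [c4 [c5]]]]] := frame x y.
move=> [[x1 [x2 [x3 [x4 x5]]]] [y5 [y4 [y3 [y2 y1]]]] L S].
have Ex u : Z.of_nat (l1 u x) = norm5 (c1 u) (c2 u) (c3 u) (c4 u) (c5 u).
  by rewrite L x1 x2 x3 x4 x5 dist5_0r.
have Exl u : (0 <= c1 u)%coqZ -> (0 <= c2 u)%coqZ -> (0 <= c3 u)%coqZ -> (0 <= c4 u)%coqZ ->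
  (0 <= c5 u)%coqZ -> Z.of_nat (l1 x u) = (c1 u + c2 u + c3 u + c4 u + c5 u)%coqZ.
  by move=> *; rewrite L x1 x2 x3 x4 x5 dist5_0l.
have Exy := Exl y ltac:(lia) ltac:(lia) ltac:(lia) ltac:(lia) ltac:(lia).
have := hull6_odd (c1 y) (c2 y) (c3 y) (c4 y) (c5 y) 0.
case; try lia.
  by rewrite Z.add_0_r -Exy odd_mod2 oxy.
move=> [s1 [s2 [s3 [s4 [s5 [s6 [[h1 [h2 [h3 [h4 [h5 h6]]]]] [hl [ho hh]]]]]]]]].
have s60 : s6 = 0%coqZ by lia.
have [s sxy [e1 [e2 [e3 [e4 e5]]]]] := S s1 s2 s3 s4 s5 ltac:(do !split; tauto).
have Exs : Z.of_nat (l1 x s) = (s1 + s2 + s3 + s4 + s5)%coqZ.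
  by rewrite (Exl s) ?e1 ?e2 ?e3 ?e4 ?e5 //; lia.
exists s; split=> //.
- by have := odd_mod2 (l1 x s); move: ho; rewrite s60 Z.add_0_r -Exs => ->; case: (odd _).
- by lia.
move=> w; have := hh (c1 w) (c2 w) (c3 w) (c4 w) (c5 w) 0%coqZ.
have -> : dist6 (c1 w) (c2 w) (c3 w) (c4 w) (c5 w) 0 s1 s2 s3 s4 s5 s6 = Z.of_nat (l1 w s).
  by rewrite L e1 e2 e3 e4 e5 s60 /dist6 /dist5 Z.add_0_r.
have -> : norm6 (c1 w) (c2 w) (c3 w) (c4 w) (c5 w) 0 = Z.of_nat (l1 w x).
  by rewrite Ex /norm6 /norm5 Z.add_0_r.
have -> : dist6 (c1 w) (c2 w) (c3 w) (c4 w) (c5 w) 0 (c1 y) (c2 y) (c3 y) (c4 y) (c5 y) 0 =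
   Z.of_nat (l1 w y).
  by rewrite L /dist6 /dist5 Z.add_0_r.
by clear; lia.
Qed.

(** A sixth coordinate, 0 at [x] and 1 at [y], makes their distance the odd number [r + 1]. In the
    exceptional case the bound on distances within [T] supplies [s] instead. *)
Lemma even_step (x y : 'rV[int]_5) r (T : 'rV[int]_5 -> Prop) : l1 x y = r -> ~~ odd r ->
  (10 <= r)%N -> (forall w, T w -> (l1 w x <= r)%N /\ (l1 w y < r)%N) ->
  (forall w w', T w -> T w' -> (l1 w w' <= r)%N) ->
  exists s, [/\ between x s y, (l1 x s < r)%N, forall w, T w -> (l1 w s < r)%N &
    forall w, (l1 w s <= maxn (l1 w x).+1 (l1 w y))%N].
Proof.
move=> xyr er gr Tr Tc; have [c1 [c2 [c3 [c4 [c5]]]]] := frame x y.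
move=> [[x1 [x2 [x3 [x4 x5]]]] [y5 [y4 [y3 [y2 y1]]]] L S].
have Ex u : Z.of_nat (l1 u x) = norm5 (c1 u) (c2 u) (c3 u) (c4 u) (c5 u).
  by rewrite L x1 x2 x3 x4 x5 dist5_0r.
have Exl u : (0 <= c1 u)%coqZ -> (0 <= c2 u)%coqZ -> (0 <= c3 u)%coqZ -> (0 <= c4 u)%coqZ ->
  (0 <= c5 u)%coqZ -> Z.of_nat (l1 x u) = (c1 u + c2 u + c3 u + c4 u + c5 u)%coqZ.
  by move=> *; rewrite L x1 x2 x3 x4 x5 dist5_0l.
have Exy := Exl y ltac:(lia) ltac:(lia) ltac:(lia) ltac:(lia) ltac:(lia).
have := hull6_odd (c1 y) (c2 y) (c3 y) (c4 y) (c5 y) 1.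
case; try lia.
- by rewrite -Exy xyr; have := odd_mod2 r.+1; rewrite Nat2Z.inj_succ /= er.
- move=> [s1 [s2 [s3 [s4 [s5 [s6 [[h1 [h2 [h3 [h4 [h5 h6]]]]] [hl [ho hh]]]]]]]]].
  have [s sxy [e1 [e2 [e3 [e4 e5]]]]] := S s1 s2 s3 s4 s5 ltac:(do !split; tauto).
  have Exs : Z.of_nat (l1 x s) = (s1 + s2 + s3 + s4 + s5)%coqZ.
    by rewrite (Exl s) ?e1 ?e2 ?e3 ?e4 ?e5 //; lia.
  pose b := Z.to_nat s6.
  have H w (z : nat) : (z <= 1)%N ->
    (l1 w s + absz (z%:Z - b%:Z) <= maxn (l1 w x + z) (l1 w y + (1 - z)))%N.
    move=> z1; have := hh (c1 w) (c2 w) (c3 w) (c4 w) (c5 w) (Z.of_nat z).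
    have -> : dist6 (c1 w) (c2 w) (c3 w) (c4 w) (c5 w) (Z.of_nat z) s1 s2 s3 s4 s5 s6 =
      (Z.of_nat (l1 w s) + Z.abs (Z.of_nat z - s6))%coqZ.
      by rewrite L e1 e2 e3 e4 e5 /dist6 /dist5.
    have -> : norm6 (c1 w) (c2 w) (c3 w) (c4 w) (c5 w) (Z.of_nat z) =
        (Z.of_nat (l1 w x) + Z.abs (Z.of_nat z))%coqZ.
      by rewrite Ex /norm6 /norm5.
    have -> : dist6 (c1 w) (c2 w) (c3 w) (c4 w) (c5 w) (Z.of_nat z)
       (c1 y) (c2 y) (c3 y) (c4 y) (c5 y) 1 =
       (Z.of_nat (l1 w y) + Z.abs (Z.of_nat z - 1))%coqZ.
      by rewrite L /dist6 /dist5.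
    by rewrite /b; move: h6 z1; clear; lia.
  have b1 : (b <= 1)%N by rewrite /b; move: h6; clear; lia.
  have oxs : odd (l1 x s + b).
    have := odd_mod2 (l1 x s + b).
    have -> : Z.of_nat (l1 x s + b) = (s1 + s2 + s3 + s4 + s5 + s6)%coqZ.
      by rewrite /b; lia.
    by rewrite ho; case: (odd _).
  exists s; split=> //.
  + have : (l1 x s + b < r.+1)%N by rewrite /b; lia.
    move: oxs er b1; clear; lia.
  (* With the parity of [|w - x|] as sixth coordinate of [w], the lifted distance to [x] is even and
     those to [x] and [y] are at most [r]. The one to [s] is then odd and at most [r], hence less
     than the even [r]. *)
  + move=> w /Tr[wx wy]; have := H w (odd (l1 w x)) (leq_b1 _).
    have := odd_l1 x w y; have := odd_l1 x w s; rewrite xyr (l1C x w).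
    move: oxs er b1 wx wy; clear.
    move: (l1 w s) (l1 w x) (l1 w y) (l1 x s) => ws wx wy xs.
    case: b => [|[|]] //; rewrite ?addn0 ?addn1; case wxo: (odd wx) => /=; lia.
  + move=> w; have := H w 1%N isT; move: b1; clear.
    move: (l1 w s) (l1 w x) (l1 w y) => ws wx wy; case: b => [|[|]] //; lia.
move=> [_ E].
pose Y a1 a2 a3 a4 a5 := exists w, T w /\
  [/\ c1 w = a1, c2 w = a2, c3 w = a3, c4 w = a4 & c5 w = a5].
have [] := @exceptional_solution (Z.of_nat r) _ _ _ _ _ Y E.
- by rewrite -xyr Exy.
- move=> a1 a2 a3 a4 a5 [w [/Tr[wx wy] [<- <- <- <- <-]]].
  by rewrite -L -Ex; split; lia.
- move=> a1 a2 a3 a4 a5 b1 b2 b3 b4 b5 [w [Tw [<- <- <- <- <-]]] [w' [Tw' [<- <- <- <- <-]]].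
  by rewrite -L; have := Tc _ _ Tw Tw'; lia.
move=> s1 [s2 [s3 [s4 [s5 [hs [hr [hh hY]]]]]]].
have [s sxy [e1 [e2 [e3 [e4 e5]]]]] := S s1 s2 s3 s4 s5 hs.
exists s; split=> //.
- suff: Z.of_nat (l1 x s) = (s1 + s2 + s3 + s4 + s5)%coqZ by move: hr; clear; lia.
  by rewrite (Exl s) ?e1 ?e2 ?e3 ?e4 ?e5 //; lia.
- move=> w Tw; suff : (Z.of_nat (l1 w s) <= Z.of_nat r - 1)%coqZ by clear; lia.
  by rewrite L e1 e2 e3 e4 e5; apply: hY; exists w; split.
move=> w; have := hh (c1 w) (c2 w) (c3 w) (c4 w) (c5 w).
by rewrite -L -Ex -e1 -e2 -e3 -e4 -e5 -L; clear; lia.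
Qed.

Lemma clique_center r (S : seq 'rV[int]_5) (B : 'rV[int]_5 -> Prop) : (10 <= r)%N -> S != [::] ->
  {in S &, forall x y, (l1 x y <= r)%N} ->
  (forall x s y, B x -> B y -> between x s y -> B s) -> {in S, forall x, B x} ->
  exists z, [/\ B z, {in S, forall y, (l1 y z < r)%N} &
    forall w rho, {in S, forall y, (l1 w y <= rho)%N} -> (l1 w z <= rho.+1)%N].
Proof.
(* The slack [k] is 1 only for even [r]. It does not accumulate: an even step bounds [|w - s|] by
   the old bound or by 1 plus the distance from [w] to a point of [S]. *)
move=> gr S0 Sr Bb SB; pose k := ~~ odd r.
suff H (Y : seq 'rV[int]_5) : {subset Y <= S} ->
    exists z, [/\ B z, {in Y, forall y, (l1 y z < r)%N} &
    forall w rho, {in S, forall y, (l1 w y <= rho)%N} -> (l1 w z <= rho + k)%N].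
  have [z [Bz zS zh]] := H S (fun _ => id); exists z; split=> // w rho /zh.
  by rewrite /k; case: odd => /=; lia.
elim: Y => [_|v Y IH YS].
  case: (S) S0 SB => // x0 S' _ SB'; exists x0; split=> //; first by apply/SB'/mem_head.
  by move=> w rho h; apply: leq_trans (leq_addr _ _); apply/h/mem_head.
have vS : v \in S by apply: YS; rewrite mem_head.
have [|z [Bz zY zh]] := IH; first by move=> y yY; apply: YS; rewrite in_cons yY orbT.
have YSr y : y \in Y -> (l1 y v <= r)%N.
  by move=> yY; apply: Sr => //; apply: YS; rewrite in_cons yY orbT.
(* The invariant is applied with [w = v] and [rho = r]. *)
have vz : (l1 v z <= r + k)%N by apply: (zh v r) => y yS; exact: Sr.
have [vzr|rvz] := ltnP (l1 v z) r.
  by exists z; split=> // y; rewrite in_cons => /predU1P[->|/zY].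
have [ovz|evz] := boolP (odd (l1 v z)).
  have [|s [bs os sz hs]] := @odd_step v z ovz.
    by move: ovz rvz vz gr; rewrite /k; clear; move: (l1 v z) => n; case ro: (odd r) => /=; lia.
  exists s; split; first exact: (Bb _ _ _ (SB _ vS) Bz bs).
  (* For [y = v], [|v - s|] is odd and less than [|v - z| <= r + k], with [k = 1] only for even [r].
     Otherwise [|y - s| = r] would force [|y - v| = r], because [|y - z| < r]; but [|v - s|] is odd,
     so these distances differ in parity. *)
  - move=> y; rewrite in_cons => /predU1P[->|yY].
      move: os sz vz ovz; rewrite /k; clear; move: (l1 v s) (l1 v z) => m n.
      by case ro: (odd r) => /=; lia.
    have := hs y; have := odd_l1 y v s; have := zY _ yY; have := YSr _ yY.
    rewrite os addbT; move: vz ovz rvz sz; rewrite /k; clear.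
    move: (l1 y v) (l1 y z) (l1 y s) (l1 v z) (l1 v s) => a b c d e.
    case ro: (odd r); case ao: (odd a) => /= ? ? ? ?; move=> ? ? ? ?; lia.
  move=> w rho h; apply: leq_trans (hs w) _; rewrite geq_max zh // andbT.
  by apply: leq_trans (leq_addr _ _); apply: h.
have er : ~~ odd r.
  apply: contra evz => ro; move: vz; rewrite /k ro addn0 => vz.
  by have /eqP-> : l1 v z == r by rewrite eqn_leq vz rvz.
have k1 : k = true by rewrite /k er.
have vzr : l1 v z = r.
  by move: evz er vz rvz; rewrite k1; clear; move: (l1 v z) => n; lia.
have [||s [bs sr sY hs]] := @even_step v z r (fun y => y \in Y) vzr er gr.
- by move=> y yY; split; [apply: YSr|apply: zY].
- by move=> y y' yY yY'; apply: Sr; apply: YS; rewrite in_cons ?yY ?yY' orbT.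
exists s; split; first exact: (Bb _ _ _ (SB _ vS) Bz bs).
- by move=> y; rewrite in_cons => /predU1P[->|/sY].
move=> w rho h; apply: leq_trans (hs w) _; rewrite geq_max zh // andbT k1 addn1 ltnS.
exact: h.
Qed.

From mathcomp Require Import all_classical all_reals all_analysis.
From mathcomp Require Import Rstruct Rstruct_topology.
From mathcomp Require Import lra.

Import Order.TTheory GRing.Theory Num.Theory.
Import numFieldNormedType.Exports.
Local Open Scope classical_set_scope.
Local Open Scope ring_scope.

(** * Collapses of simplicial complexes *)

(* [cvgD] and its like do not unify at Stdlib's [R]; these versions are meant to be applied with
   [A := R]. *)
Section RealConvergence.
Variables (S : Type) (A : realType) (F : set_system S).
Hypothesis FF : Filter F.
Implicit Types (f g : S -> A) (a b : A).

Lemma cvg_add f g a b : f @ F --> a -> g @ F --> b -> (fun p => f p + g p)%R @ F --> a + b.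
Proof. exact: cvgD. Qed.

Lemma cvg_mul f g a b : f @ F --> a -> g @ F --> b -> (fun p => f p * g p) @ F --> a * b.
Proof. exact: cvgM. Qed.

Lemma cvg_min f g a b :
  f @ F --> a -> g @ F --> b -> (fun p => Num.min (f p) (g p)) @ F --> Num.min a b.
Proof.
move=> fa gb; rewrite minr_absE.
have -> : (fun p => Num.min (f p) (g p)) = (fun p => (f p + g p - `|f p - g p|)%R / 2).
  by apply/funext => p; rewrite minr_absE.
apply: cvgM; last exact: cvg_cst.
by apply: cvgD; [exact: cvgD | apply: cvgN; apply: cvg_norm; exact: cvgB].
Qed.

Lemma cvg_max f g a b :
  f @ F --> a -> g @ F --> b -> (fun p => Num.max (f p) (g p)) @ F --> Num.max a b.
Proof.
move=> fa gb; rewrite maxr_absE.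
have -> : (fun p => Num.max (f p) (g p)) = (fun p => (f p + g p + `|f p - g p|)%R / 2).
  by apply/funext => p; rewrite maxr_absE.
apply: cvgM; last exact: cvg_cst.
by apply: cvgD; [exact: cvgD | apply: cvg_norm; exact: cvgB].
Qed.

Lemma cvg_near_gt0 f a : f @ F --> a -> 0 < a -> \forall p \near F, 0 < f p.
Proof. by move=> fa a0; exact: cvgr_gt fa _ a0. Qed.

End RealConvergence.

Lemma continuous_ap (S A B : topologicalType) (h : A -> B) (f : S -> A) :
  continuous h -> continuous f -> continuous (fun p => h (f p)).
Proof. by move=> ch cf p; apply: (cvg_comp f h (cf p)); exact: ch. Qed.

Lemma continuous_pairing (S A B : topologicalType) (f : S -> A) (g : S -> B) :
  continuous f -> continuous g -> continuous (fun p => (f p, g p)).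
Proof. by move=> cf cg p; apply: cvg_pair; [exact: cf | exact: cg]. Qed.

Lemma continuous_affine (S : topologicalType) (f : S -> R) (a b : R) :
  continuous f -> continuous (fun p => a * f p + b).
Proof.
move=> cf p; apply: (@cvg_add _ R); last exact: cvg_cst.
by apply: (@cvg_mul _ R); [exact: cvg_cst | exact: cf].
Qed.

Section Retracts.
Variable V : choiceType.
Local Notation T := {ptws V -> R}.
Implicit Types (K L : {fset V} -> Prop) (s t : {fset V}) (x : T).

Lemma ptws_cvg (F : set_system T) (x : T) : Filter F ->
  (forall v, (fun y : T => y v) @ F --> x v) -> F --> x.
Proof.
move=> FF cf; apply/cvg_sup => v A [B [[C oC <-]] Cx CA].
apply: filterS CA _; apply: cf; exact: open_nbhs_nbhs.
Qed.

Lemma ptws_continuous (S : topologicalType) (f : S -> T) :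
  (forall v, continuous (fun p => f p v)) -> continuous f.
Proof. by move=> cf p; apply: ptws_cvg => v; exact: cf. Qed.

Lemma eval_continuous (v : V) : continuous (fun x : T => x v).
Proof. exact: (@proj_continuous V (fun=> R) v). Qed.

Definition clamp (a : R) : R := Num.max 0 (Num.min a 1).

Lemma clamp_continuous : continuous clamp.
Proof.
move=> a; apply: (@cvg_max _ R); first exact: cvg_cst.
by apply: (@cvg_min _ R); [exact: cvg_id | exact: cvg_cst].
Qed.

Lemma clamp01 a : 0 <= clamp a <= 1.
Proof. by rewrite /clamp le_max lexx /= ge_max ler01 ge_min lexx orbT. Qed.

Lemma clamp_le0 a : a <= 0 -> clamp a = 0.
Proof. by move=> a0; rewrite /clamp; apply/max_idPl; rewrite ge_min a0. Qed.

Lemma clamp_ge1 a : 1 <= a -> clamp a = 1.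
Proof. by move=> a1; rewrite /clamp (min_idPr a1) (max_idPr ler01). Qed.

(* [|K|] is a strong deformation retract of [|K'|], through a homotopy defined and continuous on
   the whole space, so that homotopies compose without any gluing. *)
Definition retracts K' K := (forall x, realization K x -> realization K' x) /\
  exists D : R * T -> T, [/\ continuous D, forall x, D (0, x) = x,
   forall (a : R) x, 0 <= a <= 1 -> realization K' x -> realization K' (D (a, x)),
   forall x, realization K' x -> realization K (D (1, x)) &
   forall (a : R) x, 0 <= a <= 1 -> realization K x -> D (a, x) = x].

Lemma retracts_ext K' K K1 : (forall s, K' s <-> K1 s) -> retracts K' K -> retracts K1 K.
Proof. by move=> e; have -> : K' = K1 by apply/funext => s; exact/propext. Qed.

Lemma retracts_ext_r K' K K1 : (forall s, K s <-> K1 s) -> retracts K' K -> retracts K' K1.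
Proof. by move=> e; have -> : K = K1 by apply/funext => s; exact/propext. Qed.

Lemma retracts_refl K : retracts K K.
Proof.
split=> //; exists snd; split=> // x; exact: cvg_snd.
Qed.

Lemma retracts_trans K2 K1 K0 : retracts K2 K1 -> retracts K1 K0 -> retracts K2 K0.
Proof.
move=> [s1 [D [cD D0 DK2 DK1 Did]]] [s0 [E [cE E0 EK1 EK0 Eid]]].
have s2 x : realization K0 x -> realization K2 x by move=> /s0/s1.
(* [D] runs during the first half and [E] during the second; clamping freezes each outside its half.
   The [+ 0] fits the shape of [continuous_affine]. *)
split=> //; exists (fun p : R * T => E (clamp (2 * p.1 - 1), D (clamp (2 * p.1 + 0), p.2))); split.
- have cfst : continuous (@fst R T) by move=> p; exact: cvg_fst.
  apply: (continuous_ap cE); apply: continuous_pairing.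
    by apply: (continuous_ap clamp_continuous); apply: continuous_affine.
  apply: (continuous_ap cD); apply: continuous_pairing; last by move=> p; exact: cvg_snd.
  by apply: (continuous_ap clamp_continuous); apply: continuous_affine.
- by move=> x; rewrite /= !clamp_le0 ?E0 ?D0 //; lra.
- move=> a x a01 Kx /=; have [a2|a2] := leP (2 * a) 1.
    by rewrite [clamp (_ - _)]clamp_le0 ?E0; [exact: (DK2 _ _ (clamp01 _)) | lra].
  rewrite [clamp (2 * a + 0)]clamp_ge1; last by lra.
  by apply/s1/EK1; [exact: clamp01 | exact: DK1].
- by move=> x Kx; rewrite /= !clamp_ge1; [exact/EK0/DK1| lra | lra].
- by move=> a x a01 Kx; rewrite /= Did ?clamp01 ?Eid ?clamp01 //; exact: s0.
Qed.

End Retracts.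

Section ElementaryCollapse.
Variable V : choiceType.
Local Notation T := {ptws V -> R}.
Implicit Types (K L : {fset V} -> Prop) (s t : {fset V}) (x : T).

Lemma realization_le1 K x v : realization K x -> x v <= 1.
Proof.
move=> [x0 [s [_ xs <-]]]; have [vs|/xs ->] := boolP (v \in s); last exact: sumr_ge0.
by rewrite (big_fsetD1 v) //= lerDl sumr_ge0.
Qed.

(** The default 1 does not affect a nonempty minimum of barycentric coordinates. *)
Definition min_on (r : seq V) (x : T) : R := \big[Num.min/1]_(v <- r) x v.

Lemma min_on_continuous r : continuous (min_on r).
Proof.
elim: r => [|v r IH].
  by rewrite (_ : min_on [::] = fun=> 1);
    [move=> x; exact: cvg_cst | apply/funext => x; exact: big_nil].
rewrite (_ : min_on (v :: r) = fun x => Num.min (x v) (min_on r x)).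
  by move=> x; apply: (@cvg_min _ R); [exact: eval_continuous | exact: IH].
by apply/funext => x; exact: big_cons.
Qed.

Lemma min_on_le r x v : v \in r -> min_on r x <= x v.
Proof. by move=> vr; exact: ge_bigmin_seq. Qed.

Lemma min_on_ge0 r x : (forall v, 0 <= x v) -> 0 <= min_on r x.
Proof. by move=> x0; apply: le_bigmin => //; exact: ler01. Qed.

Lemma min_on_attained r x : r != [::] -> (forall v, x v <= 1) ->
  exists2 v, v \in r & min_on r x = x v.
Proof.
move=> r0 x1; elim: r r0 => // v [_ _|w r /(_ isT) [u ur IH] _].
  by exists v; rewrite ?mem_head // /min_on big_cons big_nil; exact/min_idPl.
rewrite /min_on big_cons -/(min_on _ _) IH; have [vu|uv] := leP (x v) (x u).
  by exists v; rewrite ?mem_head.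
by exists u; rewrite // in_cons ur orbT.
Qed.

(** The simplex [s] is a free face of the simplex obtained by adding [z]. Mass is pushed from the
    vertices of [s] to [z] at equal rates until one of them is exhausted, which lands in a facet
    belonging to [K]. *)
Lemma elementary_collapse K s z :
  (forall t u : {fset V}, (t `<=` u)%fset -> K u -> K t) ->
  s != fset0 -> z \notin s -> ~ K s -> {in s, forall v, K ((z |` s) `\ v)%fset} ->
  retracts (fun u => K u \/ u = s \/ u = (z |` s)%fset) K.
Proof.
move=> dK s0 zs Ks Kf; set K' := (fun u => _ \/ _).
(* The weights [c] sum to 0 over [s] and [z], so the flow preserves the total mass. *)
pose c v : R := if v \in s then -1 else if v == z then (size s)%:R else 0.
pose D (p : R * T) : T := fun v => p.2 v + p.1 * (c v * min_on s p.2).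
have KK' x : realization K x -> realization K' x.
  by move=> [x0 [t [Kt xt tx]]]; split=> //; exists t; split=> //; left.
have Dmin a x : min_on s x = 0 -> D (a, x) = x.
  by move=> e; apply/funext => v; rewrite /D /= e !mulr0 addr0.
(* No simplex of [K] contains [s], so a point of [|K|] vanishes at some vertex of [s] and does not
   move. *)
have min0 x t : (forall v, 0 <= x v) -> K t -> (forall v, v \notin t -> x v = 0) -> min_on s x = 0.
  move=> x0 Kt xt; apply/eqP; rewrite eq_le min_on_ge0 // andbT.
  have /fsubsetPn [v vs vt] : ~~ (s `<=` t)%fset by apply/negP => st; exact/Ks/(dK _ _ st).
  by rewrite -(xt v vt) min_on_le.
have Dfix a x : realization K x -> D (a, x) = x.
  by move=> [x0 [t [Kt xt _]]]; apply: Dmin; exact: min0 Kt xt.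
have D0 x a v : (forall v, 0 <= x v) -> 0 <= a <= 1 -> 0 <= D (a, x) v.
  move=> x0 /andP[a0 a1]; have m0 := min_on_ge0 s x0; rewrite /D /= /c; case: ifP => [vs|_].
    have := min_on_le x vs; nra.
  by case: ifP => _; rewrite ?mul0r ?mulr0 ?addr0 // addr_ge0 ?mulr_ge0.
have Dout a x v : v \notin (z |` s)%fset -> x v = 0 -> D (a, x) v = 0.
  by rewrite !inE negb_or /D /c /= => /andP[/negPf -> /negPf ->] ->; rewrite mul0r mulr0 addr0.
have Dsum a x : \sum_(v <- (z |` s)%fset) D (a, x) v = \sum_(v <- (z |` s)%fset) x v.
  have sc : \sum_(v <- s) c v = - (size s)%:R.
    rewrite big_seq (eq_bigr (fun=> -1)); last by move=> v vs; rewrite /c vs.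
    by rewrite -big_seq big_const_seq count_predT iter_addr_0 mulNrn.
  rewrite big_split /= -mulr_sumr -mulr_suml [X in X * min_on _ _]big_fsetU1 //= sc.
  by rewrite /c (negPf zs) eqxx subrr mul0r mulr0 addr0.
have tau x : realization K' x -> realization K x \/ [/\ forall v, 0 <= x v,
    forall v, v \notin (z |` s)%fset -> x v = 0 & \sum_(v <- (z |` s)%fset) x v = 1].
  move=> [x0 [t [K't xt tx]]]; have [Kt|ts] : K t \/ (t `<=` z |` s)%fset.
    by case: K't => [|[->|->]]; [left | right; exact: fsubsetUr | right].
    by left; split=> //; exists t.
  right; split=> // [v|]; first by move=> vz; apply: xt; apply: contra vz; exact: (fsubsetP ts).
  by rewrite -tx; apply/esym/big_fset_incl => // v _; exact: xt.
split=> //; exists D; split.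
- apply: ptws_continuous => v p; apply: (@cvg_add _ R).
    by apply: (cvg_comp snd (fun x : T => x v) cvg_snd); exact: eval_continuous.
  apply: (@cvg_mul _ R); first exact: cvg_fst.
  apply: (@cvg_mul _ R); first exact: cvg_cst.
  by apply: (cvg_comp snd (min_on s) cvg_snd); exact: min_on_continuous.
- by move=> x; apply/funext => v; rewrite /D /= mul0r addr0.
- move=> a x a01 K'x; have [Kx|[x0 xz sx]] := tau x K'x; first by rewrite Dfix.
  split=> [v|]; first exact: D0.
  exists (z |` s)%fset; split; [by right; right | | by rewrite Dsum].
  by move=> v vz; apply: Dout; rewrite ?xz.
- move=> x K'x; have [Kx|[x0 xz sx]] := tau x K'x; first by rewrite Dfix.
  have [v vs mv] : exists2 v, v \in (s : seq V) & min_on s x = x v.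
    by apply: min_on_attained => [|v]; [rewrite -size_eq0 cardfs_eq0|exact: realization_le1 K'x].
  have Dv : D (1, x) v = 0 by rewrite /D /c /= mv ifT // mul1r mulN1r subrr.
  split=> [w|]; first by apply: D0 => //; rewrite ler01 lexx.
  exists ((z |` s) `\ v)%fset; split; first exact: Kf.
    move=> w; rewrite in_fsetD1 negb_and negbK => /orP[/eqP -> //|wz].
    by apply: Dout; rewrite ?xz.
  have vz : v \in (z |` s)%fset by rewrite in_fset1U vs orbT.
  by apply: etrans sx; rewrite -[RHS](Dsum 1) [RHS](big_fsetD1 v vz) Dv [RHS]add0r.
- by move=> a x _; exact: Dfix.
Qed.

End ElementaryCollapse.

(** * Concatenation of infinitely many retractions *)

Section Telescope.
Variables (V : choiceType) (K : nat -> {fset V} -> Prop).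
Variable (D : nat -> R * {ptws V -> R} -> {ptws V -> R}).
Local Notation T := {ptws V -> R}.
Implicit Types (n : nat) (a : R) (x : T).
Hypothesis Kle : forall n x, realization (K n) x -> realization (K n.+1) x.
Hypothesis cD : forall n, continuous (D n).
Hypothesis D0 : forall n x, D n (0, x) = x.
Hypothesis DK : forall n a x,
  0 <= a <= 1 -> realization (K n.+1) x -> realization (K n.+1) (D n (a, x)).
Hypothesis DK1 : forall n x, realization (K n.+1) x -> realization (K n) (D n (1, x)).
Hypothesis Dfix : forall n a x, 0 <= a <= 1 -> realization (K n) x -> D n (a, x) = x.

(* The [n]-th retraction runs during the time interval [2^-(n+1), 2^-n]. *)
Fixpoint telescope n (p : R * T) : T :=
  if n is m.+1 then telescope m (p.1, D m (clamp (2 ^+ n * p.1 + -1), p.2)) else p.2.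

Lemma telescope_continuous n : continuous (telescope n).
Proof.
elim: n => [|n IH] /=; first by move=> p; exact: cvg_snd.
have cfst : continuous (@fst R T) by move=> p; exact: cvg_fst.
apply: (continuous_ap IH); apply: continuous_pairing => //.
apply: (continuous_ap (@cD n)); apply: continuous_pairing; last by move=> p; exact: cvg_snd.
by apply: (continuous_ap clamp_continuous); apply: continuous_affine.
Qed.

Lemma telescope_early n a x : 2 ^+ n * a <= 1 -> telescope n (a, x) = x.
Proof.
elim: n x => //= n IH x; rewrite exprS => a1; rewrite clamp_le0 ?D0; last by lra.
by apply: IH; have [|] := leP 0 (2 ^+ n * a); lra.
Qed.

Lemma telescopeS n a x : realization (K n) x -> telescope n.+1 (a, x) = telescope n (a, x).
Proof. by move=> Kx; rewrite /= Dfix ?clamp01. Qed.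

Lemma realization_leq m n x : (m <= n)%N -> realization (K m) x -> realization (K n) x.
Proof. by move=> /subnK <- Kx; elim: (n - m)%N => // k; exact: Kle. Qed.

(** Points of [|K m|] are fixed by every [D k] with [k >= m], so the value does not depend on the
    stage chosen. *)
Lemma telescope_eq m n a x :
  realization (K m) x -> realization (K n) x -> telescope m (a, x) = telescope n (a, x).
Proof.
wlog mn : m n / (m <= n)%N => [H Km Kn|Km _].
  by have [|/ltnW] := leqP m n => mn; [apply: H | apply/esym/H].
rewrite -(subnK mn); elim: (n - m)%N => // k ->.
by rewrite addSn telescopeS //; apply: realization_leq Km; exact: leq_addl.
Qed.

(** In the inductive step, up to time [2^-n] only [D n] can be active, and it stays in [|K n.+1|];
    afterwards it has finished and landed in [|K n|]. *)
Lemma telescope_in n a x :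
  0 <= a <= 1 -> realization (K n) x -> realization (K n) (telescope n (a, x)).
Proof.
move=> a01; elim: n x => [|n IH] x //= Kx; have [a1|a1] := leP (2 ^+ n * a) 1.
  by rewrite telescope_early //; apply: DK => //; exact: clamp01.
apply/Kle/IH; rewrite clamp_ge1; first exact: DK1.
by rewrite exprS; lra.
Qed.

Lemma telescope1 n x : realization (K n) x -> realization (K 0%N) (telescope n (1, x)).
Proof.
elim: n x => [|n IH] x //= Kx; apply: IH; rewrite clamp_ge1; first exact: DK1.
have : 1 <= 2 ^+ n :> R by rewrite exprn_ege1 // ler1n.
by rewrite exprS; lra.
Qed.

End Telescope.

Lemma contractible_union (V : choiceType) (K : nat -> {fset V} -> Prop) (o : V) :
  (forall n, retracts (K n.+1) (K n)) -> K 0%N [fset o]%fset ->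
  (forall s, K 0%N s -> (s `<=` [fset o])%fset) ->
  (forall v, exists N, forall n s, K n s -> v \in s -> K N s) ->
  contractible (realization (fun s => exists n, K n s)).
Proof.
move=> rK K0 K0o Kfin; pose T : Type := {ptws V -> R}.
have /choice [D DP] n := (rK n).2.
have Kle n := (rK n).1.
have cD n : continuous (D n) by case: (DP n).
have D0 n x : D n (0, x) = x by case: (DP n).
have DK n a x : 0 <= a <= 1 -> realization (K n.+1) x -> realization (K n.+1) (D n (a, x)).
  by case: (DP n) => _ _ h _ _; exact: h.
have DK1 n x : realization (K n.+1) x -> realization (K n) (D n (1, x)).
  by case: (DP n) => _ _ _ h _; exact: h.
have Dfix n a x : 0 <= a <= 1 -> realization (K n) x -> D n (a, x) = x.
  by case: (DP n) => _ _ _ _ h; exact: h.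
set A := realization _.
have AK x : A x -> exists n, realization (K n) x.
  by move=> [x0 [s [[n Ks] xs sx]]]; exists n; split=> //; exists s.
have KA n x : realization (K n) x -> A x.
  by move=> [x0 [s [Ks xs sx]]]; split=> //; exists s; split=> //; exists n.
(* The choice of [N] may be arbitrary, since [telescope_eq] gives the same value at any stage
   containing the point; outside [A] the stage 0 is a default. *)
have /choice [N AN] x : exists n, A x -> realization (K n) x.
  by have [/AK[n Kx]|nA] := pselect (A x); [exists n | exists 0%N].
pose d : T := fun v => if v == o then 1 else 0.
have Kd x : realization (K 0%N) x <-> x = d.
  split=> [[x0 [s [Ks xs sx]]]|->].
    have xo v : v != o -> x v = 0.
      by move=> vo; apply: xs; apply: contra vo => /(fsubsetP (K0o _ Ks)); rewrite inE.
    apply/funext => v; rewrite /d; case: eqVneq => [->|/xo //].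
    rewrite -sx (big_fset_incl _ (K0o _ Ks)) ?big_seq_fset1 // => w _; exact: xs.
  split=> [v|]; first by rewrite /d; case: ifP.
  exists [fset o]%fset; split=> // [v|]; last by rewrite big_seq_fset1 /d eqxx.
  by rewrite /d inE => /negPf ->.
exists d; split; first by apply: (KA 0%N); apply/Kd.
exists (fun p => telescope D (N p.2) p); split.
- apply/subspace_continuousP => -[a x] [/= a01 Ax].
  (* A positive coordinate [v] of [x] stays positive nearby. There all points of [A] lie in a single
     [|K M|], so the homotopy agrees with the continuous [telescope D M], also around time 0. *)
  have [v xv] : exists v, 0 < x v.
    apply/not_existsP => xn; have [x0 [s [_ _ sx]]] := Ax; have := @oner_neq0 R.
    rewrite -sx big1 ?eqxx // => v _; apply/eqP; rewrite eq_le x0 andbT leNgt.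
    by apply/negP; exact: xn.
  have [M KM] := Kfin v.
  have AM y : A y -> 0 < y v -> realization (K M) y.
    move=> [y0 [s [[n Ks] ys sy]]] yv; split=> //; exists s; split=> //; apply: (KM n) => //.
    by apply: contraTT yv => /ys ->; rewrite ltxx.
  rewrite [X in _ --> X](telescope_eq Kle Dfix a (AN x Ax) (AM x Ax xv)).
  apply: (@cvg_trans _ (telescope D M p @[p --> within (`[0, 1]%classic `*` A) (nbhs (a, x))])).
    apply: near_eq_cvg; rewrite /within /=.
    have : \forall p \near (a, x), 0 < (p.2 : T) v.
      have cv : (fun p : R * T => (p.2 : T) v) @ nbhs (a, x) --> x v.
        by apply: (cvg_comp snd (fun x : T => x v) cvg_snd); exact: eval_continuous.
      have FF : Filter (nbhs (a, x : T)) by exact: nbhs_filter.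
      exact: (@cvg_near_gt0 _ R _ FF _ _ cv xv).
    apply: filterS => -[b y] yv [_ Ay]; exact: (telescope_eq Kle Dfix b (AM _ _ _) (AN _ _)).
  apply: cvg_within_filter; exact: telescope_continuous.
- move=> a x; rewrite /= in_itv => a01 Ax.
  by apply: (KA (N x)); apply: (telescope_in Kle D0 DK DK1 a01); exact: AN.
- by move=> x Ax; apply: (telescope_early D0); rewrite mulr0 ler01.
- by move=> x Ax; apply/Kd; apply: (telescope1 DK1); exact: AN.
Qed.

(** * Matching simplices with the apices of their cores *)

Local Open Scope fset_scope.

Lemma seq_argmax (A : eqType) (m : A -> nat) (r : seq A) : r != [::] ->
  exists2 a, a \in r & forall b, b \in r -> (m b <= m a)%N.
Proof.
elim: r => // b r IH _; have [->|/IH[a ar am]] := eqVneq r [::].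
  by exists b => [|c]; rewrite inE // => /eqP ->.
have [ba|ab] := leqP (m b) (m a).
  by exists a => [|c]; rewrite inE ?ar ?orbT // => /predU1P[-> //|/am].
exists b => [|c]; rewrite ?mem_head // inE => /predU1P[-> //|/am ca].
by apply: leq_trans ca _; exact: ltnW.
Qed.

Section Cone.
Variables (V : choiceType) (P : pred V) (z : {fset V} -> V).
Implicit Types (K : {fset V} -> Prop) (s t u : {fset V}).

(** With [P] describing a face of the box, this is the part of [s] in that face. An apex off the
    face can be added or removed without changing it, which makes the matching an involution. *)
Definition core s : {fset V} := [fset v in s | P v].

Lemma core_mono s t : s `<=` t -> core s `<=` core t.
Proof.
by move=> st; apply/fsubsetP => v; rewrite !inE => /andP[/(fsubsetP st) -> ->].
Qed.

Lemma core_fset1U v s : ~~ P v -> core (v |` s) = core s.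
Proof.
by move=> Pv; apply/fsetP => w; rewrite !inE; case: eqVneq => // ->; rewrite (negPf Pv) !andbF.
Qed.

Lemma core_fsetD1 v s : ~~ P v -> core (s `\ v) = core s.
Proof.
by move=> Pv; apply/fsetP => w; rewrite !inE; case: eqVneq => // ->; rewrite (negPf Pv) !andbF.
Qed.

(* Matching [s] with its symmetric difference with [z (core s)] is acyclic: a face of maximal
   [#|core s| + #|s|] among those avoiding their apex is free. *)
Lemma retracts_matching (L : seq {fset V}) K :
  (forall s t, s `<=` t -> K t -> K s) -> K fset0 ->
  (forall s t, s `<=` t -> t \in L -> K s \/ s \in L) ->
  {in L, forall s, [/\ ~ K s, ~~ P (z (core s)), z (core s) |` s \in L & s `\ z (core s) \in L]} ->
  retracts (fun s => K s \/ s \in L) K.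
Proof.
move=> dK K0; have [n] := ubnP (size L); elim: n L => // n IH L nL dL mL.
(* Removing the apex from a member of [L] gives a member avoiding its apex, so an empty list here
   means that [L] is empty. *)
have [L0|L0] := eqVneq [seq s <- L | z (core s) \notin s] [::].
  apply: (retracts_ext _ (retracts_refl K)) => s; split=> [|[] // sL]; first by left.
  have [_ Pz _ szL] := mL s sL.
  suff : s `\ z (core s) \in [seq s <- L | z (core s) \notin s] by rewrite L0.
  by rewrite mem_filter core_fsetD1 // !inE eqxx.
have [s] := seq_argmax (fun s => size (core s) + size s)%N L0.
rewrite mem_filter => /andP[zs sL] smax.
have [Ks Pz szL _] := mL s sL; set e := z (core s) in zs Pz szL; set t := e |` s in szL.
pose L' := [seq u <- L | (u != s) && (u != t)].
(* If [u] avoids its apex, it equals [s] by maximality. Otherwise maximality against [u] without its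
   apex forces equal cores and makes [s] equal to that simplex, so [u = t]. *)
have sub_s u : u \in L -> s `<=` u -> u = s \/ u = t.
  move=> uL su; have [_ Pu _ uzL] := mL u uL.
  have [->|us] := eqVneq u s; first by left.
  have su' : (size s < size u)%N by apply: fproper_ltn_card; rewrite fproperEneq eq_sym us.
  have cu : (size (core s) <= size (core u))%N by exact/fsubset_leq_card/core_mono.
  have [zu|zu] := boolP (z (core u) \in u); last first.
    left; apply/esym/eqP; rewrite eqEfcard su /=.
    have /smax : u \in [seq s <- L | z (core s) \notin s] by rewrite mem_filter zu.
    by rewrite leqNgt -addnS leq_add.
  have cD : core (u `\ z (core u)) = core u by exact: core_fsetD1.
  have := smax (u `\ z (core u)); rewrite mem_filter cD uzL !inE eqxx => /(_ isT).
  have := cardfsD1 (z (core u)) u; rewrite zu add1n => cz m.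
  have ce : core s = core u.
    apply/eqP; rewrite eqEfcard core_mono //= -(leq_add2r (size s)).
    by apply: leq_trans m; rewrite leq_add2l -ltnS -cz.
  right; rewrite /t /e ce; have sD : s `<=` u `\ z (core u).
    apply/fsubsetP => v vs; rewrite !inE (fsubsetP su) // andbT.
    by apply: contraNneq zs => E; rewrite /e ce -E.
  have -> : s = u `\ z (core u).
    apply/eqP; rewrite eqEfcard sD /=.
    by move: m; rewrite ce leq_add2l.
  by rewrite fsetD1K.
have mL' u : u \in L' = [&& u \in L, u != s & u != t] by rewrite mem_filter andbC.
have notsub u : u \in L' -> ~~ (s `<=` u).
  by rewrite mL' => /and3P[uL us ut]; apply/negP => /(sub_s u uL) [] /eqP; apply/negP.
have LE u : u \in L <-> u \in L' \/ (u = s \/ u = t).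
  rewrite mL'; split=> [->|[/and3P[] //|[] -> //]] /=.
  case: eqVneq => [->|_] /=; first by right; left.
  by case: eqVneq => [->|_]; [right; right | left].
have st : s `<=` t by exact: fsubsetUr.
have dL' u w : u `<=` w -> w \in L' -> K u \/ u \in L'.
  move=> uw wL'; have := wL'; rewrite mL' => /andP[/(dL _ _ uw) uKL _].
  case: uKL => [|/LE[|us]]; [by left | by right |].
  case/negP: (notsub w wL'); apply: fsubset_trans uw.
  by case: us => ->.
have ct : core t = core s by exact: core_fset1U.
apply: (@retracts_trans _ _ (fun u => K u \/ u \in L')); last first.
  apply: IH => // [|u].
    apply: (@leq_trans (size L)) nL; rewrite size_filter.
    rewrite -(count_predC (fun u => (u != s) && (u != t)) L).
    by rewrite -addn1 leq_add2l -has_count; apply/hasP; exists s => //=; rewrite eqxx.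
  rewrite (mL' u) => /and3P[uL us ut].
  have [Ku Pu u1 u2] := mL u uL; split=> //.
    (* The pair [s], [t] is closed under adding and removing the apex, so no other member is sent
       into it. *)
    rewrite mL' u1 /=; apply/andP; split; apply/eqP => E.
      have cu : core u = core s by rewrite -E core_fset1U.
      by move: zs; rewrite /e -cu -E !inE eqxx.
    have cu : core u = core s by rewrite -ct -E core_fset1U.
    have [zu|zu] := boolP (z (core u) \in u).
      by move: E ut; rewrite (fsetUidPr _ _ _) ?fsub1set // => ->; rewrite eqxx.
    by move: us; rewrite -(fsetU1K zu) E cu -/e (fsetU1K zs) eqxx.
  rewrite mL' u2 /=; apply/andP; split; apply/eqP => E.
    have cu : core u = core s by rewrite -E core_fsetD1.
    have [zu|zu] := boolP (z (core u) \in u).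
      by move: ut; rewrite -(fsetD1K zu) E cu eqxx.
    by move: us; rewrite -E; move/mem_fsetD1: zu => ->; rewrite eqxx.
  have cu : core u = core s by rewrite -ct -E core_fsetD1.
  have : e \in t by rewrite !inE eqxx.
  by rewrite -E cu !inE eqxx.
apply: (@retracts_ext _ (fun u => (K u \/ u \in L') \/ u = s \/ u = t)).
  by move=> u; rewrite LE; tauto.
apply: elementary_collapse => //.
- by move=> u w uw [/(dK _ _ uw)|/(dL' _ _ uw)]; [left|].
- by apply/eqP => s0; apply: Ks; rewrite s0.
- by move=> [//|]; rewrite mL' eqxx andbF.
- move=> v vs; have := dL (t `\ v) t (fsubD1set _ _) szL => -[|tL]; first by left.
  right; rewrite mL' tL /=; apply/andP; split; apply/eqP => E.
    by move: vs; rewrite -E !inE eqxx.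
  by have := fsubsetP st v vs; rewrite -E !inE eqxx.
Qed.

(** The simplices with nonempty core form a finite list, as all lie in [X], and the cone condition
    closes this list under adding the apex, as [retracts_matching] asks. *)
Lemma retracts_cone (X : {fset V}) K :
  (forall s t, s `<=` t -> K t -> K s) -> K fset0 -> (forall s, K s -> s `<=` X) ->
  (forall s, K s -> core s != fset0 -> ~~ P (z (core s)) /\ K (z (core s) |` s)) ->
  retracts K (fun s => K s /\ core s = fset0).
Proof.
move=> dK K0 KX Kz.
pose L := [seq s <- fpowerset X | `[< K s >] && (core s != fset0)].
have LE s : s \in L <-> K s /\ core s != fset0.
  rewrite mem_filter fpowersetE; split=> [/andP[/andP[/asboolP //]]|[Ks cs]].
  by rewrite cs KX // andbT andbT; apply/asboolP.
apply: (@retracts_ext _ (fun s => (K s /\ core s = fset0) \/ s \in L)).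
  move=> s; rewrite LE; split=> [[[]|[]] //|Ks].
  by have [|] := eqVneq (core s) fset0; [left | right].
apply: retracts_matching => [s t st [Kt ct]| |s t st /LE[Kt ct]|s /LE[Ks cs]].
- split; first exact: dK Kt.
  by apply/eqP; rewrite -fsubset0 -ct core_mono.
- by split=> //; apply/eqP; rewrite -fsubset0; apply/fsubsetP => v; rewrite !inE.
- have Ks := dK _ _ st Kt; have [|] := eqVneq (core s) fset0; [by left | right].
  exact/LE.
have [Pz Kzs] := Kz s Ks cs; split=> //; first by case=> _ c0; rewrite c0 eqxx in cs.
  by apply/LE; rewrite core_fset1U.
by apply/LE; rewrite core_fsetD1 //; split=> //; apply: dK Ks; exact: fsubD1set.
Qed.

End Cone.

Local Close Scope fset_scope.

(** * Boxes *)

Definition box (lo hi : 'I_6 -> int) (x : Z6) := forall j, lo j <= x ord0 j <= hi j.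

Definition VR_in r (B : Z6 -> Prop) (s : {fset Z6}) :=
  VR_simplex manhattan r s /\ forall v, v \in s -> B v.

Lemma VR_in_sub r B (s t : {fset Z6}) : (s `<=` t)%fset -> VR_in r B t -> VR_in r B s.
Proof.
by move=> /fsubsetP st [Vt tB]; split=> [x y /st xt /st yt|v /st]; [exact: Vt | exact: tB].
Qed.

Lemma manhattanE (i : 'I_6) (x y : Z6) :
  manhattan x y = (absz (x ord0 i - y ord0 i) + l1 (col' i x) (col' i y))%N.
Proof.
rewrite /manhattan (bigD1_ord i) //=; congr (_ + _)%N.
by apply: eq_bigr => k _; rewrite !mxE.
Qed.

Lemma manhattanC (x y : Z6) : manhattan x y = manhattan y x.
Proof. exact: l1C. Qed.

Lemma manhattanxx (x : Z6) : manhattan x x = 0%N.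
Proof. exact: l1xx. Qed.

Lemma coord_le_manhattan (x y : Z6) i : (absz (x ord0 i - y ord0 i) <= manhattan x y)%N.
Proof. by rewrite (manhattanE i) leq_addr. Qed.

Lemma box_finite lo hi : exists X : {fset Z6}, forall x, box lo hi x -> x \in X.
Proof.
pose M := (\sum_j (absz (lo j) + absz (hi j)))%N.
exists [fset (\row_j ((f j : nat)%:Z - M%:Z) : Z6) | f : {ffun 'I_6 -> 'I_(M + M).+1} in predT]%fset.
move=> x bx; apply/imfsetP => /=; exists [ffun j => inord (absz (x ord0 j + M%:Z))] => //.
apply/rowP => j; rewrite mxE ffunE inordK.
  have jM : (absz (lo j) + absz (hi j) <= M)%N by rewrite /M (bigD1 j) //= leq_addr.
  by have /andP[] := bx j; move: (lo j) (hi j) (x ord0 j) M jM; clear; lia.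
have jM : (absz (lo j) + absz (hi j) <= M)%N by rewrite /M (bigD1 j) //= leq_addr.
by have /andP[] := bx j; move: (lo j) (hi j) (x ord0 j) M jM; clear; lia.
Qed.

(** * Collapsing a face of a box *)

Section Face.
Variables (r : nat) (lo hi : 'I_6 -> int) (i : 'I_6) (c c' : int).
Hypothesis r10 : (10 <= r)%N.
Hypothesis cc' : absz (c - c') = 1%N.
Hypothesis c'_in : lo i <= c' <= hi i.
Hypothesis inward : forall a, lo i <= a <= hi i -> a != c -> absz (c - a) = (absz (c' - a)).+1.

(** Deleting coordinate [i] is isometric on [s], and [clique_center] applies to the image. Its
    strict bound pays for the unit step from [c] to [c']; for [w] off the face this step brings the
    center one unit closer, which pays for the extra 1 in [rho.+1]. The hypotheses follow [exists z]
    so that [choice] yields a total function. *)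
Lemma apex (s : {fset Z6}) : exists z : Z6, s != fset0 -> VR_in r (box lo hi) s ->
  (forall v, v \in s -> v ord0 i = c) ->
  [/\ z ord0 i = c', box lo hi z, (forall y, y \in s -> manhattan y z <= r)%N &
   forall w, box lo hi w -> w ord0 i != c ->
     (forall y, y \in s -> (manhattan w y <= r)%N) -> (manhattan w z <= r)%N].
Proof.
have [->|s0] := eqVneq s fset0; first by exists 0.
have [[[Vs sB] sc]|ns] := pselect (VR_in r (box lo hi) s /\ forall v, v \in s -> v ord0 i = c);
  last by exists 0 => _ ? ?; case: ns.
pose B (u : 'rV[int]_5) := forall k, lo (lift i k) <= u ord0 k <= hi (lift i k).
have [||||z' [Bz zs zw]] := @clique_center r [seq col' i x | x <- s] B r10.
- by rewrite -size_eq0 size_map cardfs_eq0.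
- move=> _ _ /mapP[x xs ->] /mapP[y ys ->]; have := Vs x y xs ys.
  by rewrite (manhattanE i) !sc // subrr.
- by move=> x t y Bx By bt k; have := Bx k; have := By k; have := bt k; lia.
- by move=> _ /mapP[x /sB xB ->] k; rewrite mxE; exact: xB.
pose z : Z6 := \row_j (if unlift i j is Some k then z' ord0 k else c').
have zi : z ord0 i = c' by rewrite mxE unlift_none.
have zcol : col' i z = z' by apply/rowP => k; rewrite !mxE liftK.
exists z => _ _ _; split=> //.
- move=> j; have [k ->|->] := unliftP i j; last by rewrite zi.
  by rewrite mxE liftK.
- move=> y ys; rewrite (manhattanE i) zi zcol sc // cc' add1n.
  by apply: zs; exact: map_f.
- move=> w wB wc ws; have wi := inward (wB i) wc.
  have E y : y \in s -> manhattan w y = (absz (c - w ord0 i) + l1 (col' i w) (col' i y))%N.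
    by move=> ys; rewrite (manhattanE i) (sc y) // distnC.
  have [y ys] : exists y, y \in s by exact/fset0Pn.
  have le_r : (absz (c - w ord0 i) <= r)%N by apply: leq_trans (ws y ys); rewrite E // leq_addr.
  have h : (l1 (col' i w) z' <= (r - absz (c - w ord0 i)).+1)%N.
    apply: zw => _ /mapP[x xs ->]; by rewrite leq_subRL // -E // ws.
  rewrite (manhattanE i) zi zcol distnC.
  by move: h le_r wi; clear; lia.
Qed.

Lemma retracts_face :
  retracts (VR_in r (box lo hi)) (VR_in r (fun x => box lo hi x /\ x ord0 i != c)).
Proof.
have /choice [z zP] := apex.
have [X XB] := box_finite lo hi.
pose P := [pred v : Z6 | v ord0 i == c].
have coreE (s : {fset Z6}) v : v \in core P s = (v \in s) && (v ord0 i == c).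
  by rewrite !inE.
apply: (@retracts_ext_r _ _ (fun s => VR_in r (box lo hi) s /\ core P s = fset0)).
  move=> s; split=> [[[Vs sB] c0]|[Vs sB]].
    split=> // v vs; split; first exact: sB.
    by apply/negP => vc; have := coreE s v; rewrite c0 vs vc inE.
  split; first by split=> // v /sB[].
  apply/eqP/fset0Pn => -[v]; rewrite coreE => /andP[/sB[_ /negP]].
  by [].
apply: (@retracts_cone _ P z X).
- exact: VR_in_sub.
- by split=> [x y|v]; rewrite inE.
- by move=> s [_ sB]; apply/fsubsetP => v /sB /XB.
move=> s [Vs sB] s0; have sub : (core P s `<=` s)%fset.
  by apply/fsubsetP => v; rewrite coreE => /andP[].
have [] := zP (core P s) s0.
- exact: VR_in_sub sub _.
- by move=> v; rewrite coreE => /andP[_ /eqP].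
(* Points of [s] off the face are within [r] of the core because [s] is a simplex, so [zw] covers
   them. *)
move=> zi zB zy zw; have zs y : y \in s -> (manhattan y (z (core P s)) <= r)%N.
  move=> ys; have [yc|yc] := eqVneq (y ord0 i) c.
    by apply: zy; rewrite coreE ys yc eqxx.
  by apply: zw => // [|w]; [exact: sB | rewrite coreE => /andP[ws _]; exact: Vs].
split.
  by rewrite /= zi; apply/eqP => E; move: cc'; rewrite E subrr.
split=> [x y|v]; last by rewrite in_fset1U => /predU1P[->|/sB].
rewrite !in_fset1U => /predU1P[->|xs] /predU1P[->|ys].
- by rewrite manhattanxx.
- by rewrite manhattanC zs.
- exact: zs.
- exact: Vs.
Qed.

End Face.

(** One face moves at each step, in a cycle of length 12: passing from [n] to [n.+1], the upper
    bound [j] grows if [n] is [j] modulo 12, and the lower bound [j] drops if [n] is [j + 6]. The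
    first box is the origin. *)
Definition upper n (j : 'I_6) : int := ((n + 11 - j) %/ 12)%N.
Definition lower n (j : 'I_6) : int := - (((n + 5 - j) %/ 12)%N : int).

Lemma next_face n : exists i c c', [/\ absz (c - c') = 1%N, lower n.+1 i <= c' <= upper n.+1 i,
  forall a, lower n.+1 i <= a <= upper n.+1 i -> a != c -> absz (c - a) = (absz (c' - a)).+1 &
  forall x, box (lower n) (upper n) x <-> box (lower n.+1) (upper n.+1) x /\ x ord0 i != c].
Proof.
have [m6|m6] := ltnP (n %% 12) 6.
  have [i ni] : exists i : 'I_6, nat_of_ord i = (n %% 12)%N by exists (Ordinal m6).
  exists i, (upper n.+1 i), (upper n.+1 i - 1).
  have ui : upper n i = upper n.+1 i - 1 by rewrite /upper; move: (nat_of_ord i) ni m6; clear; lia.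
  have uj j : j != i -> upper n.+1 j = upper n j.
    move=> ji; have {ji} : nat_of_ord j != i by [].
    by rewrite ni /upper; move: (ltn_ord j); move: (nat_of_ord j); clear; lia.
  have lj j : lower n.+1 j = lower n j.
    by rewrite /lower; move: (ltn_ord j); move: (nat_of_ord j) m6; clear; lia.
  have lu : lower n i <= 0 <= upper n i by rewrite /lower /upper; clear; lia.
  split=> [||a|x].
  - by clear; lia.
  - by rewrite lj; move: lu ui; clear; lia.
  - by clear; lia.
  - split=> [bx|[bx xi] j].
      split=> [j|]; last by have := bx i; move: ui; clear; lia.
      have := bx j; rewrite lj; have [->|/uj -> //] := eqVneq j i.
      by move: ui; clear; lia.
    have := bx j; rewrite lj; have [->|/uj -> //] := eqVneq j i.
    by move: xi ui; clear; lia.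
have [i ni] : exists i : 'I_6, (i + 6 = n %% 12)%N.
  have m6' : (n %% 12 - 6 < 6)%N by lia.
  by exists (Ordinal m6'); rewrite /= subnK.
exists i, (lower n.+1 i), (lower n.+1 i + 1).
have ui : lower n i = lower n.+1 i + 1.
  by rewrite /lower; move: (ltn_ord i); move: (nat_of_ord i) ni m6; clear; lia.
have uj j : j != i -> lower n.+1 j = lower n j.
  move=> ji; have {ji} : nat_of_ord j != i by [].
  by rewrite /lower; move: (ltn_ord j); move: (nat_of_ord j) (nat_of_ord i) ni; clear; lia.
have lj j : upper n.+1 j = upper n j.
  by rewrite /upper; move: (ltn_ord j); move: (nat_of_ord j) m6; clear; lia.
have lu : lower n i <= 0 <= upper n i by rewrite /lower /upper; clear; lia.
split=> [||a|x].
- by clear; lia.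
- by rewrite lj; move: lu ui; clear; lia.
- by clear; lia.
- split=> [bx|[bx xi] j].
    split=> [j|]; last by have := bx i; move: ui; clear; lia.
    have := bx j; rewrite lj; have [->|/uj -> //] := eqVneq j i.
    by move: ui; clear; lia.
  have := bx j; rewrite lj; have [->|/uj -> //] := eqVneq j i.
  by move: xi ui; clear; lia.
Qed.

Theorem theorem3p13 (r : nat) : (10 <= r)%N ->
  contractible (realization (VR_simplex manhattan r)).
Proof.
move=> r10; pose K n := VR_in r (box (lower n) (upper n)).
have KV v : exists N, forall s, VR_simplex manhattan r s -> v \in s -> K N s.
  pose M := (r + \sum_j absz (v ord0 j))%N.
  (* Simplices through [v] have coordinates of size at most [M], and [12 * M.+1] steps move every
     face by [M + 1]. *)
  exists (12 * M.+1)%N => s Vs vs; split=> // w ws j.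
  have h := leq_trans (coord_le_manhattan w v j) (Vs _ _ ws vs).
  have : (r + absz (v ord0 j) <= M)%N by rewrite leq_add2l (bigD1 j) //= leq_addr.
  rewrite /upper /lower; move: h (ltn_ord j); move: (w ord0 j) (v ord0 j) (nat_of_ord j) M.
  by clear; lia.
rewrite (_ : VR_simplex manhattan r = fun s => exists n, K n s); last first.
  apply/funext => s; apply/propext; split=> [Vs|[n []] //].
  have [s0|[v vs]] := fset_0Vmem s; last by have [N KN] := KV v; exists N; exact: KN.
  by exists 0%N; split=> // v; rewrite s0 inE.
apply: (@contractible_union _ K 0).
- move=> n; have [i [c [c' [cc' c'_in inward boxE]]]] := next_face n.
  apply: retracts_ext_r (retracts_face r10 cc' c'_in inward) => s.
  by split=> -[Vs sB]; split=> // v /sB /boxE.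
- split=> [x y|x]; rewrite !inE => /eqP->; first by move=> /eqP ->; rewrite manhattanxx.
  by move=> j; rewrite mxE /lower /upper; have := ltn_ord j; lia.
- move=> s [_ sB]; apply/fsubsetP => v /sB bv; rewrite inE; apply/eqP/rowP => j.
  have := bv j; rewrite mxE /lower /upper; move: (ltn_ord j).
  by move: (v ord0 j) (nat_of_ord j); clear; lia.
- move=> v; have [N KN] := KV v; exists N => n s [Vs _]; exact: KN.
Qed.
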